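(* Suppose a spindle homomorphism $\varphi\colon X\to X'$ induces an isomorphism on normalized rack homology $\varphi_*\colon H^N(X,\partial^R)\to H^N(X',\partial^R)$. If $M$ is an $X'$-module such that the induced map $\varphi_*\colon H^N(M^\varphi;X,\partial^R)\to H^N(M;X',\partial^R)$ is also an isomorphism, then so is $\varphi_*\colon H^D(M^\varphi;X,\partial^R)\to H^D(M;X',\partial^R)$.
   Context: Let $R$ be a commutative ring with unit. A spindle is a set $X$ with a binary operation $\star$ such that $x\star x=x$ and $(x\star y)\star z=(x\star z)\star(y\star z)$; it is a quandle if every map $x\mapsto x\star y$ is invertible. An $X$-module is an $R$-module $M$ with an action of $X$, i.e. a function $\star\colon M\times X\to M$, linear in the first variable, with $(m\star x)\star y=(m\star y)\star(x\star y)$ (for a quandle one also requires each $m\mapsto m\star x$ to be invertible). Given a spindle homomorphism $\varphi\colon X\to X'$ and an $X'$-module $M$, $M^\varphi$ denotes $M$ with the $X$-action $m\star x:=m\star\varphi(x)$. The trivial operation is $x\vdash y:=x$ on $X$, with trivial action $m\vdash x:=m$ on $M$. $C_n(M;X)=M\otimes R\langle X^{n+1}\rangle$ for $n\ge0$, on sequences $(x_n,\dots,x_0)$. For $\bullet\in\{\star,\vdash\}$, $\partial^\bullet=\sum_{i=0}^n(-1)^{n-i}d^\bullet_i$ with $d^\bullet_i(m\otimes(x_n,\dots,x_0))=(m\bullet x_i)\otimes(x_n\bullet x_i,\dots,x_{i+1}\bullet x_i,x_{i-1},\dots,x_0)$; the rack differential is $\partial^R=\partial^\vdash-\partial^\star$.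 $C^D(M;X)$ is the subcomplex spanned by generators with $x_i=x_{i+1}$ for some $i$, and $C^N=C/C^D$; their homologies are $H^D(M;X,\partial^R)$ and $H^N(M;X,\partial^R)$. $H^N(X,\partial^R)$ is the case $M=R$ with trivial action. The maps $\varphi_*$ are induced by $m\otimes(x_n,\dots,x_0)\mapsto m\otimes(\varphi(x_n),\dots,\varphi(x_0))$. *)

(* Defs.v *)
From HB Require Import structures.
From mathcomp Require Import all_boot all_order all_algebra.
From mathcomp Require Import boolp.
From mathcomp Require Import finmap monalg zify.

Set Implicit Arguments.
Unset Strict Implicit.
Unset Printing Implicit Defensive.

Import GRing.Theory.

Local Open Scope ring_scope.

Section SubQuotient.
Variables (R : pzRingType) (V : lmodType R) (S : submodClosed V).

Inductive submod : predArgType := Submod u & u \in S.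
Definition submod_val w := let: Submod u _ := w in u.

HB.instance Definition _ := [isSub of submod for submod_val].
HB.instance Definition _ := [Choice of submod by <:].
HB.instance Definition _ := [SubChoice_isSubLmodule of submod by <:].

Fact submod_val_is_linear : linear submod_val. Proof. by []. Qed.
HB.instance Definition _ :=
  GRing.isLinear.Build R submod V _ submod_val submod_val_is_linear.

(* Over a ring, a [submodClosed] predicate is also closed under opposite; the
   library does not register this, and [Quotient.quot] needs it. *)
Definition submod_pred : {pred V} := fun u => u \in S.
HB.instance Definition _ :=
  GRing.isSubmodClosed.Build R V submod_pred (GRing.subsemimodClosedP S).

Definition quotmod : Type := Quotient.quot submod_pred.
HB.instance Definition _ := GRing.Zmodule.on quotmod.

Definition to_quot (u : V) : quotmod := (\pi_(Quotient.quot submod_pred) u)%qT.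

Lemma to_quotP u v : reflect (to_quot u = to_quot v) (u - v \in S).
Proof. by rewrite -[_ \in S]/(_ \in submod_pred) Quotient.idealrBE; apply: eqP. Qed.

Lemma to_quot_is_zmod : zmod_morphism to_quot.
Proof. exact: (@raddfB V (Quotient.quot submod_pred) (\pi_(Quotient.quot submod_pred))%qT). Qed.

HB.instance Definition _ :=
  GRing.isZmodMorphism.Build V quotmod to_quot to_quot_is_zmod.

Definition quot_repr (q : quotmod) : V := repr (q : Quotient.quot submod_pred).

Lemma quot_reprK : cancel quot_repr to_quot.
Proof. by move=> q; apply: reprK. Qed.

Definition quot_scale (a : R) (q : quotmod) : quotmod :=
  to_quot (a *: quot_repr q).

Lemma quot_scaleE a u : quot_scale a (to_quot u) = to_quot (a *: u).
Proof.
by apply/to_quotP; rewrite -scalerBr rpredZ //; apply/to_quotP/quot_reprK.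
Qed.

Fact quot_scaleA a b q : quot_scale a (quot_scale b q) = quot_scale (a * b) q.
Proof. by rewrite -(quot_reprK q) !quot_scaleE scalerA. Qed.
Fact quot_scale1 : left_id 1 quot_scale.
Proof. by move=> q; rewrite -(quot_reprK q) quot_scaleE scale1r. Qed.
Fact quot_scaleDr : right_distributive quot_scale +%R.
Proof.
move=> a p q; rewrite -(quot_reprK p) -(quot_reprK q) -raddfD !quot_scaleE.
by rewrite scalerDr raddfD.
Qed.
Fact quot_scaleDl q : {morph quot_scale^~ q : a b / a + b}.
Proof.
by move=> a b; rewrite -(quot_reprK q) !quot_scaleE scalerDl raddfD.
Qed.

HB.instance Definition _ := GRing.Zmodule_isLmodule.Build R quotmod
  quot_scaleA quot_scale1 quot_scaleDr quot_scaleDl.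

Fact to_quot_is_scalable : scalable to_quot.
Proof. by move=> a u; rewrite -quot_scaleE. Qed.
HB.instance Definition _ :=
  GRing.isScalable.Build R V quotmod *:%R to_quot to_quot_is_scalable.

End SubQuotient.

Section InducedMaps.
Variables (R : pzRingType) (V W : lmodType R).
Variables (S : submodClosed V) (T : submodClosed W) (f : {linear V -> W}).
Hypothesis fS : {in S, forall u, f u \in T}.

Definition submod_map (u : submod S) : submod T := Submod (fS (valP u)).

Fact submod_map_is_linear : linear submod_map.
Proof. by move=> a u v; apply: val_inj; rewrite /= linearP. Qed.
HB.instance Definition _ := GRing.isLinear.Build R (submod S) (submod T) _
  submod_map submod_map_is_linear.

Definition quot_fun (q : quotmod S) : quotmod T := to_quot T (f (quot_repr q)).

Lemma quot_funE u : quot_fun (to_quot S u) = to_quot T (f u).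
Proof.
apply/to_quotP; rewrite -linearB; apply: fS.
by apply/to_quotP; rewrite quot_reprK.
Qed.

Fact quot_fun_is_linear : linear quot_fun.
Proof.
move=> a p q; rewrite -(quot_reprK p) -(quot_reprK q) -linearP !quot_funE.
by rewrite !linearP.
Qed.

Definition quot_map : {linear quotmod S -> quotmod T} :=
  HB.pack quot_fun (GRing.isLinear.Build R (quotmod S) (quotmod T) _
    quot_fun quot_fun_is_linear).

Lemma quot_mapE u : quot_map (to_quot S u) = to_quot T (f u).
Proof. exact: quot_funE. Qed.

End InducedMaps.

Record chain_complex (R : pzRingType) := ChainComplex {
  cobj :> nat -> lmodType R;
  cdiff : forall n, {linear cobj n.+1 -> cobj n};
  cdiffK : forall n (u : cobj n.+2), cdiff n (cdiff n.+1 u) = 0 }.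

Arguments cdiff {R} c n.

Record chain_map (R : pzRingType) (C D : chain_complex R) := ChainMap {
  cmap :> forall n, {linear C n -> D n};
  cmap_diff : forall n (u : C n.+1), cmap n (cdiff C n u) = cdiff D n (cmap n.+1 u) }.

Section Homology.
Variables (R : pzRingType) (C : chain_complex R).

Definition cycle n : {pred (C n)} :=
  match n with
  | 0 => fun _ => true
  | n'.+1 => fun u => cdiff C n' u == 0
  end.

Fact cycle_closed n : submod_closed (@cycle n).
Proof.
case: n => [|n] //; split=> [|a u v]; rewrite /cycle unfold_in /= ?linear0 //.
by rewrite !unfold_in /= => /eqP u0 /eqP v0; rewrite linearP u0 v0 scaler0 addr0.
Qed.
HB.instance Definition _ n :=
  GRing.isSubmodClosed.Build R (C n) (@cycle n) (GRing.submod_closed_semi (@cycle_closed n)).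

Definition cycles n : lmodType R := submod (@cycle n).

Definition boundary n : {pred (cycles n)} :=
  fun z => `[< exists u : C n.+1, cdiff C n u = val z >].

Fact boundary_closed n : submod_closed (@boundary n).
Proof.
split=> [|a y z]; rewrite !unfold_in; first by apply/asboolP; exists 0; rewrite linear0.
move=> /asboolP[u uy] /asboolP[v vz]; apply/asboolP; exists (a *: u + v).
by rewrite linearP uy vz.
Qed.
HB.instance Definition _ n :=
  GRing.isSubmodClosed.Build R (cycles n) (@boundary n) (GRing.submod_closed_semi (@boundary_closed n)).

Definition homology n : lmodType R := quotmod (@boundary n).

End Homology.

Section HomologyMap.
Variables (R : pzRingType) (C D : chain_complex R) (f : chain_map C D).

Fact cmap_cycle n : {in @cycle R C n, forall u, f n u \in @cycle R D n}.
Proof.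
case: n => [|n] u //; rewrite !unfold_in /= => /eqP u0.
by rewrite -cmap_diff u0 linear0.
Qed.

Definition cycles_map n : {linear cycles C n -> cycles D n} :=
  submod_map (@cmap_cycle n).

Fact cycles_map_boundary n :
  {in @boundary R C n, forall z, cycles_map n z \in @boundary R D n}.
Proof.
move=> z; rewrite !unfold_in => /asboolP[u uz]; apply/asboolP.
by exists (f n.+1 u); rewrite -cmap_diff uz.
Qed.

Definition homology_map n : {linear homology C n -> homology D n} :=
  quot_map (@cycles_map_boundary n).

End HomologyMap.

Section SubQuotientComplex.
Variables (R : pzRingType) (C : chain_complex R).
Variable S : forall n, submodClosed (C n).
Hypothesis dS : forall n, {in S n.+1, forall u, cdiff C n u \in S n}.

Fact subcomplex_diffK n (u : submod (S n.+2)) :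
  submod_map (@dS n) (submod_map (@dS n.+1) u) = 0.
Proof. by apply: val_inj; apply: cdiffK. Qed.

Definition subcomplex : chain_complex R :=
  @ChainComplex R (fun n => submod (S n)) (fun n => submod_map (@dS n))
    subcomplex_diffK.

Fact quotcomplex_diffK n (q : quotmod (S n.+2)) :
  quot_map (@dS n) (quot_map (@dS n.+1) q) = 0.
Proof. by rewrite -(quot_reprK q) !quot_mapE cdiffK linear0. Qed.

Definition quotcomplex : chain_complex R :=
  @ChainComplex R (fun n => quotmod (S n)) (fun n => quot_map (@dS n))
    quotcomplex_diffK.

End SubQuotientComplex.

Section SubQuotientComplexMap.
Variables (R : pzRingType) (C D : chain_complex R) (f : chain_map C D).
Variables (S : forall n, submodClosed (C n)) (T : forall n, submodClosed (D n)).
Hypothesis dS : forall n, {in S n.+1, forall u, cdiff C n u \in S n}.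
Hypothesis dT : forall n, {in T n.+1, forall u, cdiff D n u \in T n}.
Hypothesis fS : forall n, {in S n, forall u, f n u \in T n}.

Fact subcomplex_map_diff n (u : subcomplex dS n.+1) :
  submod_map (@fS n) (cdiff (subcomplex dS) n u) =
  cdiff (subcomplex dT) n (submod_map (@fS n.+1) u).
Proof. by apply: val_inj; apply: cmap_diff. Qed.

Definition subcomplex_map : chain_map (subcomplex dS) (subcomplex dT) :=
  @ChainMap R (subcomplex dS) (subcomplex dT)
    (fun n => submod_map (@fS n)) subcomplex_map_diff.

Fact quotcomplex_map_diff n (q : quotcomplex dS n.+1) :
  quot_map (@fS n) (cdiff (quotcomplex dS) n q) =
  cdiff (quotcomplex dT) n (quot_map (@fS n.+1) q).
Proof.
rewrite -[RHS]/(quot_map (@dT n) (quot_map (@fS n.+1) q)).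
rewrite -[cdiff _ n q]/(quot_map (@dS n) q).
by rewrite -(quot_reprK q) !quot_mapE cmap_diff.
Qed.

Definition quotcomplex_map : chain_map (quotcomplex dS) (quotcomplex dT) :=
  @ChainMap R (quotcomplex dS) (quotcomplex dT)
    (fun n => quot_map (@fS n)) quotcomplex_map_diff.

End SubQuotientComplexMap.

(* [M (x) R<K>] is the direct sum of copies of [M] indexed by [K], realised as
   the finitely supported functions [K -> M]; the generator [m (x) k] is
   [<< m *g k >>]. *)
Definition tensfree (R : pzRingType) (M : lmodType R) (K : choiceType) : Type :=
  {malg M[K]}.

Section TensFree.
Variables (R : pzRingType) (M : lmodType R) (K : choiceType).

HB.instance Definition _ := GRing.Zmodule.on (tensfree M K).

Implicit Types (c : tensfree M K) (k : K).

Definition tf_scale (a : R) c : tensfree M K :=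
  [malg k in msupp c => a *: c@_k].

Lemma tf_scaleE a c k : (tf_scale a c)@_k = a *: c@_k.
Proof. by rewrite mcoeffE; case: msuppP; rewrite ?scaler0. Qed.

Fact tf_scaleA a b c : tf_scale a (tf_scale b c) = tf_scale (a * b) c.
Proof. by apply/malgP => k; rewrite !tf_scaleE scalerA. Qed.
Fact tf_scale1 : left_id 1 tf_scale.
Proof. by move=> c; apply/malgP => k; rewrite tf_scaleE scale1r. Qed.
Fact tf_scaleDr : right_distributive tf_scale +%R.
Proof.
by move=> a c d; apply/malgP => k; rewrite !(tf_scaleE, mcoeffD) scalerDr.
Qed.
Fact tf_scaleDl c : {morph tf_scale^~ c : a b / a + b}.
Proof.
by move=> a b; apply/malgP => k; rewrite !(tf_scaleE, mcoeffD) scalerDl.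
Qed.

HB.instance Definition _ := GRing.Zmodule_isLmodule.Build R (tensfree M K)
  tf_scaleA tf_scale1 tf_scaleDr tf_scaleDl.

Lemma mcoeffZ a c k : (a *: c)@_k = a *: c@_k.
Proof. exact: tf_scaleE. Qed.

Definition tens k (m : M) : tensfree M K := << m *g k >>.

Fact tens_is_linear k : linear (tens k).
Proof.
move=> a m n; apply/malgP => l.
by rewrite mcoeffD mcoeffZ !mcoeffU mulrnDl scalerMnr.
Qed.
HB.instance Definition _ k :=
  GRing.isLinear.Build R M (tensfree M K) _ (tens k) (tens_is_linear k).

Lemma tensE c : c = \sum_(k <- msupp c) tens k c@_k.
Proof. exact: monalgE. Qed.

(* The linear map [M (x) R<K> -> N] with [m (x) k |-> f k m]. *)
Section Extension.
Variables (N : lmodType R) (f : K -> {linear M -> N}).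

Definition tf_ext c : N := \sum_(k <- msupp c) f k c@_k.

Lemma tf_extEw (d : {fset K}) c : {subset msupp c <= d} ->
  tf_ext c = \sum_(k <- d) f k c@_k.
Proof.
move=> cd; rewrite /tf_ext; apply: big_fset_incl => [|k kd]; first exact/fsubsetP.
by rewrite -mcoeff_eq0 => /eqP->; rewrite linear0.
Qed.

Fact tf_ext_is_linear : linear tf_ext.
Proof.
move=> a c d; pose e := (msupp c `|` msupp d)%fset.
rewrite (@tf_extEw e c) ?(@tf_extEw e d) ?(@tf_extEw e (a *: c + d)).
- rewrite scaler_sumr -big_split /=; apply: eq_bigr => k _.
  by rewrite mcoeffD mcoeffZ linearP.
- move=> k; rewrite in_fsetU -!mcoeff_neq0 mcoeffD mcoeffZ.
  apply: contraLR; rewrite negb_or !negbK => /andP[/eqP-> /eqP->].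
  by rewrite scaler0 addr0.
- by move=> k kd; rewrite in_fsetU kd orbT.
- by move=> k kc; rewrite in_fsetU kc.
Qed.
HB.instance Definition _ :=
  GRing.isLinear.Build R (tensfree M K) N _ tf_ext tf_ext_is_linear.

Lemma tf_ext_tens k m : tf_ext (tens k m) = f k m.
Proof.
rewrite (@tf_extEw [fset k]%fset) ?big_seq_fset1 ?mcoeffUU //.
exact/fsubsetP/msuppU_le.
Qed.

End Extension.

Lemma eq_tensfree (N : lmodType R) (f g : {linear tensfree M K -> N}) :
  (forall k m, f (tens k m) = g (tens k m)) -> f =1 g.
Proof.
by move=> fg c; rewrite [c]tensE !linear_sum; apply: eq_bigr => k _.
Qed.

End TensFree.

HB.mixin Record isSpindle X of Choice X := {
  sop : X -> X -> X;
  sop_idem : idempotent_op sop;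
  sop_dist : forall x y z, sop (sop x y) z = sop (sop x z) (sop y z) }.

#[short(type="spindleType")]
HB.structure Definition Spindle := {X of Choice X & isSpindle X}.

Record spindle_hom (X X' : spindleType) := SpindleHom {
  shom :> X -> X';
  shomM : {morph shom : x y / sop x y} }.

(* An [X]-module structure on [M]: [act x m] is the paper's [m * x]. *)
Record action (R : pzRingType) (X : spindleType) (M : lmodType R) := Action {
  act :> X -> {linear M -> M};
  act_dist : forall m x y, act y (act x m) = act (sop x y) (act y m) }.

Definition trivial_action (R : pzRingType) (X : spindleType) (M : lmodType R) :
    action X M :=
  @Action R X M (fun=> idfun) (fun _ _ _ => erefl).

Section Pullback.
Variables (R : pzRingType) (X X' : spindleType) (phi : spindle_hom X X').
Variables (M : lmodType R) (a : action X' M).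

Fact pullback_dist m x y :
  a (phi y) (a (phi x) m) = a (phi (sop x y)) (a (phi y) m).
Proof. by rewrite shomM act_dist. Qed.

Definition pullback : action X M :=
  @Action R X M (fun x => a (phi x)) pullback_dist.

End Pullback.

(* The sequence [(x_n, ..., x_0)] is stored by its indices: [x i] is [x_i]. *)
Notation seqs X n := {ffun 'I_n.+1 -> X}.
Notation chains M X n := (tensfree M (seqs X n)).

Section Faces.
Variables (R : comPzRingType) (X : spindleType) (M : lmodType R).

(* [op x y] and [ac y m] stand for [x * y] and [m * y]. *)
Section Operation.
Variables (op : X -> X -> X) (ac : X -> {linear M -> M}).

Definition face_seq n (i : 'I_n.+2) (x : seqs X n.+1) : seqs X n :=
  [ffun k : 'I_n.+1 =>
     if (k < i)%N then x (lift i k) else op (x (lift i k)) (x i)].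

Definition face n (i : 'I_n.+2) : {linear chains M X n.+1 -> chains M X n} :=
  tf_ext (fun x => tens (face_seq i x) \o ac (x i)).

Lemma face_tens n (i : 'I_n.+2) x m :
  face i (tens x m) = tens (face_seq i x) (ac (x i) m).
Proof. exact: tf_ext_tens. Qed.

Definition partial n (c : chains M X n.+1) : chains M X n :=
  \sum_(i < n.+2) (-1) ^+ (n.+1 - i) *: face i c.

End Operation.

Arguments face op ac {n} i : simpl never.

Lemma face_face (op1 op2 : X -> X -> X) (ac1 ac2 : X -> {linear M -> M}) n
    (i : 'I_n.+2) (j : 'I_n.+3) (i' : 'I_n.+3) (j' : 'I_n.+2) :
    (forall x y z, op1 (op2 x y) z = op2 (op1 x z) (op1 y z)) ->
    (forall m x y, ac1 y (ac2 x m) = ac2 (op1 x y) (ac1 y m)) ->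
    i' = i :> nat -> j = j'.+1 :> nat -> (i <= j')%N ->
  forall c, face op1 ac1 i (face op2 ac2 j c) = face op2 ac2 j' (face op1 ac1 i' c).
Proof.
move=> opD acD ii jj ij.
apply: (@eq_tensfree _ _ _ _ (face op1 ac1 i \o face op2 ac2 j)
  (face op2 ac2 j' \o face op1 ac1 i')) => x m.
rewrite /= !face_tens.
have -> : face_seq op2 j x i = x i'.
  rewrite ffunE jj ltnS ij; congr (x _); apply: val_inj.
  by rewrite /= /bump jj ltnNge ij /= ii.
have -> : face_seq op1 i' x j' = op1 (x j) (x i').
  rewrite ffunE ii ltnNge ij /=; congr (op1 (x _) _).
  by apply: val_inj; rewrite /= /bump ii ij jj.
rewrite acD; congr (tens _ _); apply/ffunP => k; rewrite !ffunE.
have Li : lift j i = i'.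
  by apply: val_inj; rewrite /= /bump jj ltnNge ij ii.
have Lj : lift i' j' = j.
  by apply: val_inj; rewrite /= /bump ii ij jj.
have Lk : lift j (lift i k) = lift i' (lift j' k).
  apply: val_inj; rewrite /= /bump jj ii.
  case: (leqP i k) => ik; case: (leqP j' k) => jk //=.
  - by rewrite !add1n ltnS jk (leq_trans ik).
  - by rewrite !add0n !add1n !ltnS leqNgt jk /= ik.
  - by case/negP: (ltn_geF (leq_trans ik ij)); rewrite jk.
  by rewrite !add0n ltnNge (ltnW jk) /= leqNgt ik.
rewrite Lk Li Lj /= /bump jj ii !ltnS ij [(j' < i)%N]ltnNge ij /=.
case: (leqP i k) => ik; case: (leqP j' k) => jk; rewrite ?(add0n, add1n) ?ik ?jk.
- by rewrite ltnNge (leqW ik) opD.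
- by rewrite ltnNge ik.
- by have := leq_trans (leq_trans ik ij) jk; rewrite ltnn.
by rewrite (ltnW jk).
Qed.

Lemma alt_sum0 (V : lmodType R) N (G : nat -> nat -> V) :
    (forall i j, (i <= j <= N)%N -> G i j.+1 = G j i) ->
  \sum_(i < N.+1) \sum_(j < N.+2) (-1) ^+ (i + j) *: G i j = 0.
Proof.
move=> GE; have split_sum (i : 'I_N.+1) :
  \sum_(j < N.+2) (-1) ^+ (i + j) *: G i j =
    \sum_(j < N.+1 | (j <= i)%N) (-1) ^+ (i + j) *: G i j
    - \sum_(j < N.+1 | (i <= j)%N) (-1) ^+ (j + i) *: G j i.
  rewrite (bigID (fun j : 'I_N.+2 => (j <= i)%N)) /=; congr (_ + _).
    rewrite big_mkcond big_ord_recr /= leqNgt ltn_ord /= addr0.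
    by rewrite [RHS]big_mkcond.
  rewrite big_mkcond big_ord_recl /= add0r -sumrN [RHS]big_mkcond.
  apply: eq_bigr => j _; rewrite /bump /= add1n -ltnNge ltnS.
  case: (leqP i j) => // ij.
  have -> : G i j.+1 = G j i by apply: GE; rewrite ij -ltnS ltn_ord.
  by rewrite addnS exprS mulN1r scaleNr [(i + j)%N]addnC.
rewrite (eq_bigr _ (fun i _ => split_sum i)) big_split /= sumrN.
under eq_bigr do rewrite big_mkcond.
under [X in _ - X]eq_bigr do rewrite big_mkcond.
by rewrite [X in _ - X]exchange_big /= subrr.
Qed.

Lemma linear_crossB (U V : lmodType R) (f g f' g' : {linear U -> V}) u v u' v' :
    f u = f' u' -> f v = g' u' -> g u = f' v' -> g v = g' v' ->
  f (u - v) - g (u - v) = f' (u' - v') - g' (u' - v').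
Proof. by rewrite !linearB /= => -> -> -> ->; rewrite addrACA. Qed.

Variable a : action X M.

Local Notation d_triv := (face (fun x _ : X => x) (trivial_action X M)).
Local Notation d_star := (face sop a).

Definition rack_diff n (c : chains M X n.+1) : chains M X n :=
  partial (fun x _ => x) (trivial_action X M) c - partial sop a c.

Definition rack_face n (i : 'I_n.+2) (c : chains M X n.+1) : chains M X n :=
  d_triv i c - d_star i c.

Lemma rack_diffE n (c : chains M X n.+1) :
  rack_diff c = \sum_(i < n.+2) (-1) ^+ (n.+1 - i) *: rack_face i c.
Proof.
by rewrite /rack_diff -sumrB; apply: eq_bigr => i _; rewrite -scalerBr.
Qed.

Fact rack_face_is_linear n (i : 'I_n.+2) : linear (rack_face i).
Proof. exact: (linearP (d_triv i \- d_star i)). Qed.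
HB.instance Definition _ n (i : 'I_n.+2) := GRing.isLinear.Build R
  (chains M X n.+1) (chains M X n) _ (rack_face i) (rack_face_is_linear i).

Fact rack_diff_is_linear n : linear (@rack_diff n).
Proof.
move=> k c d; rewrite !rack_diffE scaler_sumr -big_split.
apply: eq_bigr => i _ /=.
by rewrite (linearP (rack_face i)) scalerDr !scalerA mulrC.
Qed.
HB.instance Definition _ n := GRing.isLinear.Build R (chains M X n.+1)
  (chains M X n) _ (@rack_diff n) (@rack_diff_is_linear n).

Lemma rack_face_face n (i : 'I_n.+2) (j : 'I_n.+3) (i' : 'I_n.+3)
    (j' : 'I_n.+2) c : i' = i :> nat -> j = j'.+1 :> nat -> (i <= j')%N ->
  rack_face i (rack_face j c) = rack_face j' (rack_face i' c).
Proof.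
move=> ii jj ij.
have tt := @face_face (fun x _ => x) (fun x _ => x) (trivial_action X M)
  (trivial_action X M) n i j i' j'
  (fun _ _ _ => erefl) (fun _ _ _ => erefl) ii jj ij c.
have ts := @face_face (fun x _ => x) sop (trivial_action X M) a n i j i' j'
  (fun _ _ _ => erefl) (fun _ _ _ => erefl) ii jj ij c.
have st := @face_face sop (fun x _ => x) a (trivial_action X M) n i j i' j'
  (fun _ _ _ => erefl) (fun _ _ _ => erefl) ii jj ij c.
have ss := @face_face sop sop a a n i j i' j'
  (@sop_dist X) (@act_dist _ _ _ a) ii jj ij c.
exact: linear_crossB tt ts st ss.
Qed.

Lemma rack_diffK n (c : chains M X n.+2) : rack_diff (rack_diff c) = 0.
Proof.
pose G i j := rack_face (inord i : 'I_n.+2) (rack_face (inord j : 'I_n.+3) c).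
have GE i j : (i <= j <= n.+1)%N -> G i j.+1 = G j i.
  case/andP=> ij jn; have im := leq_trans ij jn.
  by apply: rack_face_face; rewrite !inordK ?ltnS // (leqW im).
rewrite rack_diffE.
transitivity (- \sum_(i < n.+2) \sum_(j < n.+3) (-1) ^+ (i + j) *: G i j);
  last by rewrite alt_sum0 ?oppr0.
rewrite -sumrN; apply: eq_bigr => i _; rewrite rack_diffE.
rewrite (linear_sum (rack_face i)) scaler_sumr -sumrN.
apply: eq_bigr => j _; rewrite (linearZZ (rack_face i)) scalerA /G !inord_val.
rewrite -scaleNr; congr (_ *: _); rewrite -[RHS]mulN1r -exprS -exprD.
rewrite -signr_odd -[RHS]signr_odd oddS !oddD !oddB ?leq_ord //=.
by case: (odd n); case: (odd i); case: (odd j).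
Qed.

Definition rack_complex : chain_complex R :=
  @ChainComplex R (fun n => chains M X n) rack_diff rack_diffK.

Definition degenerate n : pred (seqs X n) := fun x =>
  [exists i : 'I_n.+1, exists j : 'I_n.+1, (j == i.+1 :> nat) && (x j == x i)].

Definition degenerate_chain n : {pred rack_complex n} :=
  fun c => all (@degenerate n) (msupp (c : chains M X n)).

Fact degenerate_chain_closed n : submod_closed (@degenerate_chain n).
Proof.
split=> [|k c d cD dD]; first by apply/allP => x; rewrite msupp0.
apply/allP => x; apply: contraLR => xD; rewrite -mcoeff_eq0 mcoeffD mcoeffZ.
have vanish (e : chains M X n) : e \in @degenerate_chain n -> e@_x = 0.
  by move=> /allP eD; apply: mcoeff_outdom; apply: contra xD; apply: eD.
by rewrite !vanish // scaler0 addr0.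
Qed.
HB.instance Definition _ n := GRing.isSubmodClosed.Build R (rack_complex n)
  (@degenerate_chain n) (GRing.submod_closed_semi (@degenerate_chain_closed n)).

Lemma tens_degenerate n x m : degenerate x ->
  tens x m \in @degenerate_chain n.
Proof. by move=> xD; apply/allP => y /(fsubsetP msuppU_le); rewrite inE => /eqP->. Qed.

(* The support condition above is membership in the span of the generators
   [m (x) x] with [x] degenerate. *)
Lemma degenerate_chainP n (c : rack_complex n) :
  reflect (exists s : seq (seqs X n * M),
             all (fun p => degenerate p.1) s /\ c = \sum_(p <- s) tens p.1 p.2)
          (c \in @degenerate_chain n).
Proof.
apply: (iffP idP) => [cD | [s [/allP sD ->]]]; last first.
  by rewrite big_seq rpred_sum // => p ps; apply/tens_degenerate/sD.
exists [seq (x, mcoeff x c) | x <- msupp (c : chains M X n)]; split.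
  by rewrite all_map.
by rewrite big_map; apply: tensE.
Qed.

Lemma degenerate_face_seq op n (i p q : 'I_n.+2) (x : seqs X n.+1) :
    q = p.+1 :> nat -> x q = x p -> i != p -> i != q ->
  degenerate (face_seq op i x).
Proof.
move=> qp xqp ip iq; have [p' pE _] := unlift_some ip.
have [q' qE _] := unlift_some iq.
apply/existsP; exists p'; apply/existsP; exists q'.
have {}ip : i <> p :> nat by move=> /val_inj/eqP; apply/negP.
have {}iq : i <> q :> nat by move=> /val_inj/eqP; apply/negP.
have pp : p = ((i <= p') + p')%N :> nat by rewrite pE.
have qq : q = ((i <= q') + q')%N :> nat by rewrite qE.
have q'p' : q' = p'.+1 :> nat by clear -pp qq ip iq qp; lia.
rewrite q'p' eqxx /= !ffunE -pE -qE xqp q'p'.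
suff -> : (p'.+1 < i)%N = (p' < i)%N by [].
by clear -pp qq ip iq qp q'p'; lia.
Qed.

Lemma eq_face_seq op n (p q : 'I_n.+2) (x : seqs X n.+1) :
    (forall y, op y y = y) -> q = p.+1 :> nat -> x q = x p ->
  face_seq op p x = face_seq op q x.
Proof.
move=> opI qp xqp; apply/ffunP => k; rewrite !ffunE qp ltnS.
have [kp | pk | kp] := ltngtP k p.
- congr (x _); apply: val_inj; rewrite /= /bump qp; lia.
- rewrite xqp; congr (op (x _) _); apply: val_inj; rewrite /= /bump qp; lia.
- have -> : lift p k = q by apply: val_inj; rewrite /= /bump qp; lia.
  have -> : lift q k = p by apply: val_inj; rewrite /= /bump qp; lia.
  by rewrite xqp opI.
Qed.

Lemma rack_diff_degenerate n :
  {in @degenerate_chain n.+1, forall c, rack_diff c \in @degenerate_chain n}.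
Proof.
move=> c /degenerate_chainP[s [sD ->]].
rewrite linear_sum big_seq rpred_sum // => -[x m] /(allP sD) /=.
case/existsP=> p /existsP[q /andP[/eqP qp /eqP xqp]].
have pq : q != p by rewrite -val_eqE /= qp; lia.
have Fpq : rack_face p (tens x m) = rack_face q (tens x m).
  rewrite /rack_face !face_tens xqp (@eq_face_seq sop _ p q) //; last exact: sop_idem.
  by rewrite (@eq_face_seq _ _ p q).
rewrite rack_diffE (bigD1 p) //= (bigD1 q) //= addrA Fpq -scalerDl.
have -> : (n.+1 - p = (n.+1 - q).+1)%N by move: (ltn_ord q); rewrite qp; lia.
rewrite exprS mulN1r addNr scale0r add0r rpred_sum // => i /andP[ip iq].
apply: rpredZ; rewrite /rack_face !face_tens.
by apply: rpredB; apply/tens_degenerate/(@degenerate_face_seq _ _ i p q).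
Qed.

Definition degenerate_complex : chain_complex R :=
  subcomplex (S := fun n => @degenerate_chain n) rack_diff_degenerate.

Definition normalized_complex : chain_complex R :=
  quotcomplex (S := fun n => @degenerate_chain n) rack_diff_degenerate.

End Faces.

Arguments face {R X M} op ac {n} i : simpl never.
Arguments rack_complex {R X M} a.
Arguments degenerate_complex {R X M} a.
Arguments normalized_complex {R X M} a.

Definition HD (R : comPzRingType) (X : spindleType) (M : lmodType R)
  (a : action X M) n : lmodType R := homology (degenerate_complex a) n.

Definition HN (R : comPzRingType) (X : spindleType) (M : lmodType R)
  (a : action X M) n : lmodType R := homology (normalized_complex a) n.

Definition compatible (R : pzRingType) (X X' : spindleType)
    (phi : spindle_hom X X') (M : lmodType R) (a : action X M)
    (a' : action X' M) : Prop :=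
  forall x, a x =1 a' (phi x).

Section RackMap.
Variables (R : comPzRingType) (X X' : spindleType) (phi : spindle_hom X X').
Variables (M : lmodType R) (a : action X M) (a' : action X' M).
Hypothesis aa' : compatible phi a a'.

Definition seq_map n (x : seqs X n) : seqs X' n := [ffun k => phi (x k)].

Definition push n : {linear chains M X n -> chains M X' n} :=
  tf_ext (fun x => tens (seq_map x)).

Lemma push_tens n (x : seqs X n) m : push n (tens x m) = tens (seq_map x) m.
Proof. exact: tf_ext_tens. Qed.

Lemma seq_map_face op op' n (i : 'I_n.+2) x :
    {morph phi : y z / op y z >-> op' y z} ->
  seq_map (face_seq op i x) = face_seq op' i (seq_map x).
Proof. by move=> phiM; apply/ffunP => k; rewrite !ffunE; case: ifP. Qed.

Lemma push_rack_diff n (c : rack_complex a n.+1) :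
  push n (rack_diff a c) = rack_diff a' (push n.+1 c).
Proof.
move: c; apply: (@eq_tensfree _ _ _ _ (push n \o @rack_diff _ _ _ a n)
  (@rack_diff _ _ _ a' n \o push n.+1)) => x m.
change (push n (rack_diff a (tens x m)) = rack_diff a' (push n.+1 (tens x m))).
rewrite push_tens !rack_diffE (linear_sum (push n)).
apply: eq_bigr => i _; rewrite (linearZZ (push n)) (linearB (push n)).
rewrite !face_tens !push_tens aa' /rack_face !face_tens ffunE.
by rewrite (@seq_map_face sop sop) ?(@seq_map_face _ (fun y _ => y)) //; apply: shomM.
Qed.

Lemma push_degenerate n :
  {in @degenerate_chain _ _ _ a n, forall c,
     push n c \in @degenerate_chain _ _ _ a' n}.
Proof.
move=> c /degenerate_chainP[s [sD ->]].
rewrite linear_sum big_seq rpred_sum // => -[x m] /(allP sD) /=.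
case/existsP=> p /existsP[q /andP[qp /eqP xqp]]; rewrite push_tens.
apply: tens_degenerate; apply/existsP; exists p; apply/existsP; exists q.
by rewrite qp !ffunE xqp eqxx.
Qed.

Definition rack_map : chain_map (rack_complex a) (rack_complex a') :=
  @ChainMap R (rack_complex a) (rack_complex a') push push_rack_diff.

Definition HD_map n : {linear HD a n -> HD a' n} :=
  homology_map (subcomplex_map (f := rack_map)
    (@rack_diff_degenerate _ _ _ a) (@rack_diff_degenerate _ _ _ a')
    push_degenerate) n.

Definition HN_map n : {linear HN a n -> HN a' n} :=
  homology_map (quotcomplex_map (f := rack_map)
    (@rack_diff_degenerate _ _ _ a) (@rack_diff_degenerate _ _ _ a')
    push_degenerate) n.

End RackMap.

Arguments HD_map {R X X'} phi {M} a a' aa' n.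
Arguments HN_map {R X X'} phi {M} a a' aa' n.

Section Compatible.
Variables (R : pzRingType) (X X' : spindleType) (phi : spindle_hom X X').
Variable M : lmodType R.

Lemma pullback_compatible (a : action X' M) :
  compatible phi (pullback phi a) a.
Proof. by []. Qed.

Lemma trivial_compatible :
  compatible phi (trivial_action X M) (trivial_action X' M).
Proof. by []. Qed.

End Compatible.

Arguments pullback_compatible {R X X'} phi {M} a.
Arguments trivial_compatible {R X X'} phi M.

(* Main.v *)
Require Import Defs.
From HB Require Import structures.
From mathcomp Require Import all_boot all_order all_algebra.
From mathcomp Require Import boolp.
From mathcomp Require Import finmap monalg zify.

(* Degenerate sequences are filtered by the position of their first repetition
   [x_i = x_(i+1)], counted from [x_0]. A repeated pair is never deleted by the
   rack differential (its two faces cancel), so the part of the degenerate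
   complex where that repetition sits at a given place is a sum, over
   nondegenerate words [k], of copies of the augmented complex [C(M; X)], with
   [x_n, ..., x_(i+2)] as the coefficient of [k = (x_i, ..., x_0)]. The letters
   of [k] act on these coefficients, but [c - c * x] is the boundary of the
   chain obtained by appending [x] to the cycle [c]; hence the E^1 page of the
   filtration is [H(C(M; X)) (x) C^N(X)], the second factor having trivial
   coefficients. In the mapping cone of [phi] on degenerate chains, with the
   source filtered one step lower than the target, E^1 becomes
   [H(C(M; X')) (x) Q], [Q] being the cone of [C^N(X) -> C^N(X')], provided that
   [C(M; X) -> C(M; X')] is a homology isomorphism in lower degrees, which holds
   by induction. As [Q] is free, acyclic and bounded below, it is contractible
   and E^2 vanishes. The spectral sequence is unrolled into a descent on the
   filtration degree of relative cycles. *)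

Set Implicit Arguments.
Unset Strict Implicit.
Unset Printing Implicit Defensive.

Import GRing.Theory.
Local Open Scope ring_scope.

(** * Linear predicates and finitely supported chains *)

(** A submodule given by a [Prop]: existential conditions such as being a boundary take this form
    directly. *)
Definition lin_closed (R : pzRingType) (V : lmodType R) (W : V -> Prop) :=
  W 0 /\ forall r u v, W u -> W v -> W (r *: u + v).

Section LinClosed.
Variables (R : pzRingType) (V : lmodType R) (W : V -> Prop).
Hypothesis Wlin : lin_closed W.

Lemma lin_closed0 : W 0. Proof. exact: Wlin.1. Qed.

Lemma lin_closedD u v : W u -> W v -> W (u + v).
Proof. by move=> Wu Wv; rewrite -[u]scale1r; apply: Wlin.2. Qed.

Lemma lin_closedZ r u : W u -> W (r *: u).
Proof. by move=> Wu; rewrite -[_ *: _]addr0; apply: Wlin.2 => //; apply: lin_closed0. Qed.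

Lemma lin_closedN u : W u -> W (- u).
Proof. by move=> Wu; rewrite -scaleN1r; apply: lin_closedZ. Qed.

Lemma lin_closedB u v : W u -> W v -> W (u - v).
Proof. by move=> Wu Wv; apply: lin_closedD => //; apply: lin_closedN. Qed.

Lemma lin_closed_sum (I : Type) (s : seq I) (F : I -> V) :
  (forall i, W (F i)) -> W (\sum_(i <- s) F i).
Proof. by move=> WF; apply: big_ind => //; [apply: lin_closed0 | apply: lin_closedD]. Qed.

End LinClosed.

Lemma lin_closed_im (R : pzRingType) (V V' : lmodType R) (f : {linear V -> V'}) :
  lin_closed (fun y => exists x, f x = y).
Proof.
split=> [|r _ _ [x <-] [y <-]]; first by exists 0; rewrite linear0.
by exists (r *: x + y); rewrite linearP.
Qed.

Section Span.
Variables (R : pzRingType) (M : lmodType R) (K : choiceType).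
Implicit Types (c d : tensfree M K) (k l : K) (P Q : pred K).

Lemma mcoeff_tens k l (m : M) : (tens k m)@_l = if k == l then m else 0.
Proof. by rewrite mcoeffU; case: eqP. Qed.

Definition tspan P : {pred tensfree M K} := fun c => all P (msupp c).

Lemma tspanP P c : reflect (forall k, ~~ P k -> c@_k = 0) (c \in tspan P).
Proof.
apply: (iffP allP) => [cP k kP | c0 k].
  by apply: mcoeff_outdom; apply: contra kP; apply: cP.
by rewrite -mcoeff_neq0; apply: contraR => /c0->.
Qed.

Fact tspan_closed P : submod_closed (tspan P).
Proof.
split=> [|r c d /tspanP cP /tspanP dP]; first by apply/tspanP=> k _; rewrite mcoeff0.
by apply/tspanP=> k kP; rewrite mcoeffD Defs.mcoeffZ cP ?dP // scaler0 addr0.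
Qed.
HB.instance Definition _ P := GRing.isSubmodClosed.Build R (tensfree M K)
  (tspan P) (GRing.submod_closed_semi (tspan_closed P)).

Lemma lin_closed_tspan P : lin_closed (fun c => c \in tspan P).
Proof. by split=> [|r c d cP dP]; rewrite ?rpred0 // rpredD ?rpredZ. Qed.

Lemma tens_tspan P k m : P k -> tens k m \in tspan P.
Proof. by move=> Pk; apply/tspanP=> l; rewrite mcoeff_tens; case: eqP => [<-|//]; rewrite Pk. Qed.

Lemma sub_tspan P Q c : (forall k, P k -> Q k) -> c \in tspan P -> c \in tspan Q.
Proof. by move=> PQ /allP cP; apply/allP=> k /cP/PQ. Qed.

Lemma tspan_and P Q c : (c \in tspan (fun k => P k && Q k)) = (c \in tspan P) && (c \in tspan Q).
Proof. exact: all_predI. Qed.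

Lemma tspan0 c : c \in tspan xpred0 -> c = 0.
Proof. by move=> /tspanP c0; apply/malgP => k; rewrite c0 ?mcoeff0. Qed.

Lemma tf_ind_coef (T : tensfree M K -> Prop) c : T 0 ->
  (forall c d, T c -> T d -> T (c + d)) -> (forall k, k \in msupp c -> T (tens k c@_k)) -> T c.
Proof.
move=> T0 TD Tk; rewrite [c]tensE big_seq.
by apply: (big_ind T) => // k; apply: Tk.
Qed.

Lemma tf_ind (T : tensfree M K -> Prop) : T 0 ->
  (forall c d, T c -> T d -> T (c + d)) -> (forall k m, T (tens k m)) -> forall c, T c.
Proof. by move=> T0 TD Tk c; apply: tf_ind_coef => // k _; apply: Tk. Qed.

Lemma tf_ind_tspan P (T : tensfree M K -> Prop) c : c \in tspan P -> T 0 ->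
  (forall c d, T c -> T d -> T (c + d)) -> (forall k m, P k -> T (tens k m)) -> T c.
Proof. by move=> /allP cP T0 TD Tk; apply: tf_ind_coef => // k /cP; apply: Tk. Qed.

Section Ext.
Variables (N : lmodType R).

Lemma linear_tspan (f : {linear tensfree M K -> N}) (S : submodClosed N) P c :
  c \in tspan P -> (forall k m, P k -> f (tens k m) \in S) -> f c \in S.
Proof.
move=> cP fS; apply: (@tf_ind_tspan P (fun c => f c \in S) c cP) => [|d e dS eS|//].
  by rewrite linear0 rpred0.
by rewrite linearD rpredD.
Qed.

Lemma eq_on_tspan (f g : {linear tensfree M K -> N}) P c : c \in tspan P ->
  (forall k m, P k -> f (tens k m) = g (tens k m)) -> f c = g c.
Proof.
move=> cP fg; apply: (@tf_ind_tspan P (fun c => f c = g c) c cP) => [|d e fgd fge|//].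
  by rewrite !linear0.
by rewrite !linearD fgd fge.
Qed.

End Ext.

Lemma linear_coef_closed (N : lmodType R) (L : choiceType)
    (f : {linear tensfree M K -> tensfree N L}) (W : M -> Prop) (W' : N -> Prop) c :
  lin_closed W' -> (forall k m, W m -> forall l : L, W' (f (tens k m))@_l) ->
  (forall k, W c@_k) -> forall l : L, W' (f c)@_l.
Proof.
move=> W'lin fW cW l; rewrite [c]tensE linear_sum (raddf_sum (mcoeff l)).
by apply: (lin_closed_sum W'lin) => k; apply: fW.
Qed.

Definition tspan_proj P : {linear tensfree M K -> tensfree M K} :=
  tf_ext (fun k => if P k then tens k : {linear _ -> _} else \0).

Lemma tspan_projE P c k : (tspan_proj P c)@_k = if P k then c@_k else 0.
Proof.
elim/tf_ind: c => [|c d Hc Hd|l m].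
- by rewrite linear0 mcoeff0 if_same.
- by rewrite linearD !mcoeffD Hc Hd; case: ifP; rewrite ?addr0.
rewrite [tspan_proj _ _]tf_ext_tens; case: ifP => Pl; rewrite ?mcoeff_tens ?mcoeff0.
  by case: eqP => [<-|]; rewrite ?Pl ?if_same.
by case: eqP => [<-|]; rewrite ?Pl ?if_same.
Qed.

Lemma tspan_proj_tspan P c : tspan_proj P c \in tspan P.
Proof. by apply/tspanP => k /negbTE Pk; rewrite tspan_projE Pk. Qed.

Lemma tspan_proj_sub P Q c : c \in tspan Q -> tspan_proj P c \in tspan Q.
Proof. by move=> /tspanP cQ; apply/tspanP => k /cQ ck; rewrite tspan_projE ck if_same. Qed.

Lemma tspan_proj_predC P c : c - tspan_proj P c \in tspan (predC P).
Proof.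
by apply/tspanP => k; rewrite negbK => Pk; rewrite mcoeffB tspan_projE Pk subrr.
Qed.

End Span.

Arguments tspan {R M K} P.
Arguments tspan_proj {R M K} P.

Section CoefMap.
Variables (R : pzRingType) (K : choiceType).

Definition map_coef (M N : lmodType R) (g : {linear M -> N}) :
    {linear tensfree M K -> tensfree N K} :=
  tf_ext (fun k => tens k \o g).

Variables (M N : lmodType R) (g : {linear M -> N}).

Lemma map_coef_tens k m : map_coef g (tens k m) = tens k (g m).
Proof. exact: tf_ext_tens. Qed.

Lemma map_coefE c k : (map_coef g c)@_k = g c@_k.
Proof.
elim/tf_ind: c => [|c d Hc Hd|l m]; rewrite ?linear0 ?mcoeff0 ?linear0 //.
  by rewrite linearD !mcoeffD Hc Hd linearD.
by rewrite map_coef_tens !mcoeff_tens; case: eqP; rewrite ?linear0.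
Qed.

Lemma map_coef_tspan P c : c \in tspan P -> map_coef g c \in tspan P.
Proof. by move=> /tspanP cP; apply/tspanP => k /cP ck; rewrite map_coefE ck linear0. Qed.

(** The chosen preimages are used only on the support of [d], so the lift is finitely supported;
    [T 0 0] accounts for the other keys. *)
Lemma coef_lift (T : M -> N -> Prop) (d : tensfree N K) P : d \in tspan P ->
  T 0 0 -> (forall k, exists m, T m d@_k) ->
  exists2 c : tensfree M K, c \in tspan P & forall k, T c@_k d@_k.
Proof.
move=> dP T0 /choice[m mT].
exists [malg k in msupp d => m k].
  apply/tspanP => k kP; rewrite mcoeffE; case: ifP => // kd.
  by move: kd; rewrite -mcoeff_neq0 (tspanP _ _ dP) ?eqxx.
by move=> k; rewrite mcoeffE; case: msuppP => // kd.
Qed.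

End CoefMap.

Arguments map_coef {R K M N} g.

(** * Words and the place of their first repetition *)

(* [rep s w]: two consecutive letters among the first [s + 1] letters of [w]
   coincide. *)
Fixpoint rep (X : eqType) (s : nat) (w : seq X) : bool :=
  match s, w with
  | s'.+1, x :: ((y :: _) as w') => (x == y) || rep s' w'
  | _, _ => false
  end.

Definition degen (X : eqType) (w : seq X) := rep (size w) w.

Section Rep.
Variable X : eqType.
Implicit Types (x y : X) (v w : seq X) (s : nat).

Lemma rep0 w : rep 0 w = false. Proof. by case: w. Qed.

Lemma rep_nil s : rep s ([::] : seq X) = false. Proof. by case: s. Qed.

Lemma repS s x y w : rep s.+1 [:: x, y & w] = (x == y) || rep s (y :: w).
Proof. by []. Qed.

Lemma rep_leq s t w : (s <= t)%N -> rep s w -> rep t w.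
Proof.
elim: s t w => [|s IHs] [|t] [|x [|y w]] //= st /orP[->//|].
by move=> /(IHs t (y :: w) st) /= ->; rewrite orbT.
Qed.

(** A word of length n has n - 1 consecutive pairs, so [rep s] stops growing at s = n - 1. *)
Lemma rep_size s w : rep s w -> ((size w).-1 <= s)%N -> rep (size w).-1 w.
Proof.
elim: s w => [|s IHs] [|x [|y w]] //= /orP[->//|rw st].
by apply/orP; right; apply: (IHs (y :: w)).
Qed.

Lemma rep_degen s w : rep s w -> degen w.
Proof.
move=> rw; have [sw|/ltnW sw] := leqP s (size w); first exact: rep_leq rw.
rewrite /degen; apply: (@rep_leq (size w).-1); first exact: leq_pred.
apply: (rep_size rw); exact: leq_trans (leq_pred _) sw.
Qed.

Lemma degen_rep w s : ((size w).-1 <= s)%N -> degen w -> rep s w.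
Proof.
move=> ws dw; apply: rep_leq ws _; apply: (rep_size dw); exact: leq_pred.
Qed.

Lemma rep_lt s w : rep s w -> ~~ rep s.-1 w -> (s < size w)%N.
Proof.
case: s => [|s]; first by rewrite rep0.
move=> rw /= nw; rewrite ltnNge; apply: contra nw => ws.
by apply: degen_rep (rep_degen rw); case: (size w) ws.
Qed.

Lemma rep_cons s x w : rep s w -> rep s.+1 (x :: w).
Proof. by case: w => [|y w] rw; [rewrite rep_nil in rw | rewrite repS rw orbT]. Qed.

Lemma rep_map (Y : eqType) (f : X -> Y) s w : rep s w -> rep s (map f w).
Proof.
elim: s w => [|s IHs] [|x [|y w]] //= /orP[/eqP->|/IHs]; first by rewrite eqxx.
by rewrite /= => ->; rewrite orbT.
Qed.

(* For [k] nondegenerate of size [s], the words [dup k u] are those satisfying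
   [rep s] but not [rep s.-1]. *)
Definition dup (k u : seq X) : seq X :=
  if k is x :: k' then k ++ last x k' :: u else [::].
Arguments dup : simpl never.

Lemma dup_cons x y k u : dup [:: x, y & k] u = x :: dup (y :: k) u.
Proof. by []. Qed.

Lemma size_dup k u : k != [::] -> size (dup k u) = (size k + size u).+1.
Proof. by case: k => // x k _; rewrite size_cat /= addnS. Qed.

Lemma rep_dup k u : k != [::] -> rep (size k) (dup k u).
Proof.
case: k => // x k _; elim: k x => [|y k IHk] x; first by rewrite /dup /= eqxx.
by rewrite dup_cons; apply/rep_cons/IHk.
Qed.

Lemma rep_pred_dup k u : rep (size k).-1 (dup k u) = degen k.
Proof.
case: k => // x k /=; elim: k x => [|y k IHk] x //.
by rewrite dup_cons /= IHk.
Qed.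

(** The only pair that [rep s] sees and [rep s.-1] does not is formed by letters s and s + 1,
    counted from 1. It is therefore the repeated one, and letter s + 1 can be recovered from the
    prefix of length s. *)
Lemma dup_rep s w : rep s w -> ~~ rep s.-1 w ->
  w = dup (take s w) (drop s.+1 w) /\ ~~ degen (take s w).
Proof.
elim: s w => [|s IHs] w; first by rewrite rep0.
case: w => [|x [|y w]] //= rw; case: s IHs rw => [|s] IHs.
  by rewrite /= orbF => /eqP-> _; rewrite /dup /= ?take0 ?drop0.
rewrite repS negb_or => rw /andP[xy nw].
have {}rw : rep s.+1 (y :: w) by move: rw; rewrite (negbTE xy).
have [dE nd] := IHs _ rw nw.
rewrite [take _ (y :: w)]/= [drop _ (y :: w)]/= in dE nd *.
rewrite dup_cons -[RHS]/(x :: dup _ (drop s.+1 w)) -dE; split=> //.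
by rewrite /degen [size _]/= repS negb_or xy.
Qed.

Lemma take_dup k u : take (size k) (dup k u) = k.
Proof. by case: k => // x k; rewrite /dup take_size_cat. Qed.

Lemma drop_dup k u : k != [::] -> drop (size k).+1 (dup k u) = u.
Proof.
case: k => // x k _; rewrite /dup -cat_rcons drop_size_cat //.
by rewrite size_rcons.
Qed.

End Rep.

(** * The augmented rack complex on words *)

HB.lock Definition push_letter (R : pzRingType) (X : choiceType) (M : lmodType R) (x : X) :
    {linear tensfree M (seq X) -> tensfree M (seq X)} :=
  tf_ext (fun w => tens (x :: w)).

HB.lock Definition word_act (R : pzRingType) (X : spindleType) (M : lmodType R)
    (a : action X M) (x : X) : {linear tensfree M (seq X) -> tensfree M (seq X)} :=
  tf_ext (fun w => tens [seq sop y x | y <- w] \o a x).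

Fixpoint word_diff (R : comPzRingType) (X : spindleType) (M : lmodType R)
    (a : action X M) (w : seq X) : {linear M -> tensfree M (seq X)} :=
  if w is x :: w' then
    (tens w' \- (word_act a x \o tens w')) \- (push_letter M x \o word_diff a w')
  else \0.

(* Up to the sign [(-1) ^ n] in degree [n], the rack differential, augmented
   by the module [M] of empty words in degree [-1]. The word [x :: w] stands
   for the sequence with [x_0 = x]. *)
HB.lock Definition wdiff (R : comPzRingType) (X : spindleType) (M : lmodType R)
    (a : action X M) : {linear tensfree M (seq X) -> tensfree M (seq X)} :=
  tf_ext (word_diff a).

Arguments push_letter {R X M} x.

Section Words.
Variables (R : comPzRingType) (X : spindleType) (M : lmodType R) (a : action X M).
Local Notation C := (tensfree M (seq X)).
Local Notation push_letter := (@push_letter R X M).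
Local Notation word_act := (word_act a).
Local Notation wdiff := (wdiff a).

Lemma push_letter_tens x w m : push_letter x (tens w m) = tens (x :: w) m.
Proof. by rewrite push_letter.unlock; apply: tf_ext_tens. Qed.

Lemma word_act_tens x w m :
  word_act x (tens w m) = tens [seq sop y x | y <- w] (a x m).
Proof. by rewrite word_act.unlock; apply: tf_ext_tens. Qed.

Lemma wdiff_nil m : wdiff (tens [::] m) = 0.
Proof. by rewrite wdiff.unlock; apply: tf_ext_tens. Qed.

Lemma wdiff_cons x w m : wdiff (tens (x :: w) m) =
  tens w m - word_act x (tens w m) - push_letter x (wdiff (tens w m)).
Proof.
have E v n : wdiff (tens v n) = word_diff a v n.
  by rewrite wdiff.unlock; apply: tf_ext_tens.
by rewrite !E.
Qed.

Lemma push_letter_tspan (P Q : pred (seq X)) x (c : C) :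
  (forall w, P w -> Q (x :: w)) -> c \in tspan P -> push_letter x c \in tspan Q.
Proof.
by move=> PQ cP; apply: (linear_tspan cP) => w m /PQ; rewrite push_letter_tens; apply: tens_tspan.
Qed.

Lemma word_act_tspan (P Q : pred (seq X)) x (c : C) :
  (forall w, P w -> Q [seq sop y x | y <- w]) ->
  c \in tspan P -> word_act x c \in tspan Q.
Proof.
by move=> PQ cP; apply: (linear_tspan cP) => w m /PQ; rewrite word_act_tens; apply: tens_tspan.
Qed.

(** The first letter contributes the difference of [c] and its image under [x]; all other faces keep
    that letter and change sign. Thus [push_letter x] is a chain homotopy between [word_act x] and
    the identity. *)
Lemma wdiff_push x c :
  wdiff (push_letter x c) = c - word_act x c - push_letter x (wdiff c).
Proof.
elim/tf_ind: c => [|c d Hc Hd|w m].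
- by rewrite !linear0 !addr0.
- by rewrite !linearD /= Hc Hd addrACA [X in X + _]addrACA.
by rewrite push_letter_tens wdiff_cons.
Qed.

Lemma word_act_push x y c :
  word_act y (push_letter x c) = push_letter (sop x y) (word_act y c).
Proof.
elim/tf_ind: c => [|c d Hc Hd|w m]; first by rewrite !linear0.
  by rewrite !linearD /= Hc Hd.
by rewrite push_letter_tens !word_act_tens push_letter_tens.
Qed.

Lemma word_act_act x y c :
  word_act y (word_act x c) = word_act (sop x y) (word_act y c).
Proof.
elim/tf_ind: c => [|c d Hc Hd|w m]; first by rewrite !linear0.
  by rewrite !linearD /= Hc Hd.
rewrite !word_act_tens act_dist -!map_comp; congr (tens _ _).
by apply: eq_map => z /=; rewrite sop_dist.
Qed.

Lemma wdiff_act x c : wdiff (word_act x c) = word_act x (wdiff c).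
Proof.
elim/tf_ind: c => [|c d Hc Hd|w m]; first by rewrite !linear0.
  by rewrite !linearD /= Hc Hd.
elim: w m => [|y w IHw] m; first by rewrite word_act_tens !wdiff_nil linear0.
rewrite -push_letter_tens word_act_push !wdiff_push IHw !linearB /=.
by rewrite word_act_push -word_act_act.
Qed.

Lemma wdiffK c : wdiff (wdiff c) = 0.
Proof.
elim/tf_ind: c => [|c d Hc Hd|w m]; first by rewrite !linear0.
  by rewrite !linearD /= Hc Hd addr0.
elim: w m => [|y w IHw] m; first by rewrite wdiff_nil linear0.
rewrite -push_letter_tens wdiff_push linearB (linearB wdiff (tens w m)) /=.
by rewrite [wdiff (push_letter _ _)]wdiff_push IHw wdiff_act linear0 subr0 subrr.
Qed.

(* A repeated pair of letters is never deleted: its two faces cancel. *)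
Lemma wdiff_push2 x c :
  wdiff (push_letter x (push_letter x c)) = push_letter x (push_letter x (wdiff c)).
Proof.
rewrite !wdiff_push word_act_push sop_idem.
rewrite (linearB (push_letter x) (c - _)) (linearB (push_letter x) c) /=.
by rewrite opprB addrC subrK.
Qed.

Lemma wdiff_size n c : c \in tspan (fun w => size w == n) ->
  wdiff c \in tspan (fun w => (size w).+1 == n).
Proof.
move=> cn; apply: (linear_tspan cn) => w m /eqP <- {n c cn}.
elim: w m => [|x w IHw] m; first by rewrite wdiff_nil rpred0.
rewrite -push_letter_tens wdiff_push !rpredB ?tens_tspan ?word_act_tens ?tens_tspan ?size_map //.
by apply: push_letter_tspan (IHw m) => v /=.
Qed.

Lemma wdiff_rep s c : c \in tspan (rep s) -> wdiff c \in tspan (rep s).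
Proof.
move=> cs; apply: (linear_tspan cs) => w m {c cs}.
elim: s w m => [|s IHs] w m; first by rewrite rep0.
case: w => [|x [|y w]] // /orP[/eqP<-|rw].
  rewrite -!push_letter_tens wdiff_push2.
  (* A chain whose words all begin with [x] acquires a repetition at the first pair when [x] is
     pushed once more. *)
  apply: (@push_letter_tspan (fun w => ohead w == Some x)) => [[|z v] //= /eqP[->]|].
    by rewrite eqxx.
  by apply: (@push_letter_tspan predT) => //; apply/tspanP.
have rw' : tens (y :: w) m \in tspan (rep s) by apply: tens_tspan.
rewrite -push_letter_tens wdiff_push !rpredB //.
- by apply: sub_tspan rw' => v; apply: rep_leq.
- by apply: word_act_tspan rw' => v rv; apply/(rep_leq (leqnSn s))/rep_map.
by apply: push_letter_tspan (IHs _ _ rw) => v; apply: rep_cons.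
Qed.

Lemma wdiff_degen c : c \in tspan (@degen X) -> wdiff c \in tspan (@degen X).
Proof.
move=> cD; apply: (linear_tspan cD) => w m wD.
apply: (sub_tspan (@rep_degen _ (size w))).
by apply/wdiff_rep/tens_tspan.
Qed.

End Words.

(** * Symbols of degenerate chains *)

(** The key [k] ends in the letter to be repeated, and its coefficient is a chain in the letters
    that follow. An empty key has no letter to repeat and goes to 0. *)
HB.lock Definition dup_map (R : comPzRingType) (X : choiceType) (M : lmodType R) :
    {linear tensfree (tensfree M (seq X)) (seq X) -> tensfree M (seq X)} :=
  tf_ext (fun k => if k is [::] then \0 : {linear _ -> _}
                   else tf_ext (fun u => tens (dup k u))).

(* The symbol of a chain of [tspan (rep s)] modulo [tspan (rep s.-1)], a
   section of [dup_map]: it sends [dup k u] to [u (x) k], for [k] nondegenerate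
   of size [s]. *)
HB.lock Definition dup_symb (R : comPzRingType) (X : choiceType) (M : lmodType R) (s : nat) :
    {linear tensfree M (seq X) -> tensfree (tensfree M (seq X)) (seq X)} :=
  tf_ext (fun w => if rep s w && ~~ rep s.-1 w
                   then tens (take s w) \o tens (drop s.+1 w) : {linear _ -> _}
                   else \0).

(* Modulo the trivial words, the augmented complex becomes the unaugmented
   normalized one. *)
Definition trivial_word (X : eqType) (w : seq X) := nilp w || degen w.

Section DupMap.
Variables (R : comPzRingType) (X : spindleType) (M : lmodType R) (a : action X M).
Local Notation C := (tensfree M (seq X)).
Local Notation dup_map := (dup_map X M).
Local Notation dup_symb := (dup_symb X M).
Local Notation wdiff := (wdiff a).
Implicit Types (c : C) (g : tensfree C (seq X)).

Lemma dup_map_nil l : dup_map (tens [::] l) = 0.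
Proof. by rewrite dup_map.unlock; apply: tf_ext_tens. Qed.

Lemma dup_map_tens k u m : k != [::] ->
  dup_map (tens k (tens u m)) = tens (dup k u) m.
Proof.
case: k => // x k _; rewrite dup_map.unlock [LHS]tf_ext_tens.
exact: tf_ext_tens.
Qed.

Lemma dup_map1 x l : dup_map (tens [:: x] l) = push_letter x (push_letter x l).
Proof.
elim/tf_ind: l => [|l l' Hl Hl'|u m]; first by rewrite !linear0.
  by rewrite !linearD /= Hl Hl'.
by rewrite dup_map_tens // !push_letter_tens.
Qed.

Lemma dup_map_cons x y k l :
  dup_map (tens [:: x, y & k] l) = push_letter x (dup_map (tens (y :: k) l)).
Proof.
elim/tf_ind: l => [|l l' Hl Hl'|u m]; first by rewrite !linear0.
  by rewrite !linearD /= Hl Hl'.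
by rewrite !dup_map_tens // !push_letter_tens.
Qed.

Lemma dup_map_push x g : g \in tspan (predC (@nilp X)) ->
  dup_map (push_letter x g) = push_letter x (dup_map g).
Proof.
move=> gP; apply: (@tf_ind_tspan _ _ _ _ (fun g => dup_map (push_letter x g) =
  push_letter x (dup_map g)) g gP) => [|d e Hd He|[|y k] l _] //.
- by rewrite !linear0.
- by rewrite !linearD /= Hd He.
by rewrite push_letter_tens dup_map_cons.
Qed.

Lemma word_act_dup x k l : word_act a x (dup_map (tens k l)) =
  dup_map (tens [seq sop y x | y <- k] (word_act a x l)).
Proof.
case: k => [|y k]; first by rewrite !dup_map_nil linear0.
elim: k y => [|z k IHk] y; first by rewrite !dup_map1 !word_act_push.
by rewrite dup_map_cons word_act_push IHk -dup_map_cons.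
Qed.

Lemma dup_map_rep s g : g \in tspan (fun k => size k == s) ->
  dup_map g \in tspan (rep s).
Proof.
move=> gs; apply: (linear_tspan gs) => k l /eqP <-.
case: k => [|x k]; first by rewrite dup_map_nil rpred0.
elim/tf_ind: l => [|l l' Hl Hl'|u m]; first by rewrite !linear0 rpred0.
  by rewrite !linearD rpredD.
by rewrite dup_map_tens // tens_tspan // rep_dup.
Qed.

Lemma dup_map_trivial s g :
  g \in tspan (fun k => (size k == s) && trivial_word k) ->
  dup_map g \in tspan (rep s.-1).
Proof.
move=> gs; apply: (linear_tspan gs) => k l /andP[/eqP <-].
case: k => [|x k] kD; first by rewrite dup_map_nil rpred0.
elim/tf_ind: l => [|l l' Hl Hl'|u m]; first by rewrite !linear0 rpred0.
  by rewrite !linearD rpredD.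
by rewrite dup_map_tens // tens_tspan // rep_pred_dup.
Qed.

Lemma dup_map_degen g : dup_map g \in tspan (@degen X).
Proof.
elim/tf_ind: g => [|g h Hg Hh|k l]; first by rewrite linear0 rpred0.
  by rewrite linearD rpredD.
apply: (sub_tspan (@rep_degen _ (size k))).
by apply: dup_map_rep; apply: tens_tspan.
Qed.

Lemma dup_map_size s p g : g \in tspan (fun k => size k == s) ->
  (forall k, g@_k \in tspan (fun u => size u == p)) ->
  dup_map g \in tspan (fun w => size w == (s + p).+1).
Proof.
move=> gs gp; apply: (@tf_ind_coef _ _ _ (fun g => dup_map g \in _)).
- by rewrite linear0 rpred0.
- by move=> c d Hc Hd; rewrite linearD rpredD.
move=> k kg; have /eqP ks := allP gs k kg.
case: k ks {kg} => [|x k] ks; first by rewrite dup_map_nil rpred0.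
apply: (@tf_ind_tspan _ _ _ _ (fun l => dup_map (tens (x :: k) l) \in _) _ (gp (x :: k))).
- by rewrite !linear0 rpred0.
- by move=> l l' Hl Hl'; rewrite !linearD rpredD.
move=> u m /eqP up; rewrite dup_map_tens // tens_tspan //.
by rewrite size_dup // ks up.
Qed.

Lemma dup_symb_tens s w m : dup_symb s (tens w m) =
  if rep s w && ~~ rep s.-1 w then tens (take s w) (tens (drop s.+1 w) m) else 0.
Proof.
rewrite dup_symb.unlock; etransitivity; first exact: tf_ext_tens.
by case: ifP => rw; rewrite [X in if X then _ else _]rw.
Qed.

Lemma dup_symb_tspan s c :
  dup_symb s c \in tspan (fun k => (size k == s) && ~~ trivial_word k).
Proof.
elim/tf_ind: c => [|c d Hc Hd|w m]; first by rewrite linear0 rpred0.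
  by rewrite linearD rpredD.
rewrite dup_symb_tens; case: ifP => [/andP[rw nw]|_]; last exact: rpred0.
have sw := rep_lt rw nw; have [_ nd] := dup_rep rw nw.
apply: tens_tspan; rewrite size_take sw eqxx /trivial_word negb_or nd andbT.
by case: s w rw sw {nw nd} => [|s] [|x w] //; rewrite rep0.
Qed.

Lemma dup_symb_size s p c : c \in tspan (fun w => size w == (s + p).+1) ->
  forall k, (dup_symb s c)@_k \in tspan (fun u => size u == p).
Proof.
move=> cp k; apply: (@tf_ind_tspan _ _ _ _ (fun c => (dup_symb s c)@_k \in _) _ cp).
- by rewrite linear0 mcoeff0 rpred0.
- by move=> d e Hd He; rewrite linearD mcoeffD rpredD.
move=> w m /eqP ws; rewrite dup_symb_tens; case: ifP => _; last by rewrite mcoeff0 rpred0.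
rewrite mcoeff_tens; case: ifP => _; last exact: rpred0.
by apply: tens_tspan; rewrite size_drop ws subSS addKn.
Qed.

Lemma dup_symb_low s c : c \in tspan (rep s.-1) -> dup_symb s c = 0.
Proof.
move=> cs; apply: (@tf_ind_tspan _ _ _ _ (fun c => dup_symb s c = 0) _ cs).
- by rewrite linear0.
- by move=> d e Hd He; rewrite linearD /= Hd He addr0.
by move=> w m rw; rewrite dup_symb_tens rw andbF.
Qed.

(** Together with [dup_symb_low] and [dup_mapK], this identifies [tspan (rep s)] modulo
    [tspan (rep s.-1)] with chains on the nontrivial keys of length s. *)
Lemma dup_symbK s c : c \in tspan (rep s) ->
  c - dup_map (dup_symb s c) \in tspan (rep s.-1).
Proof.
move=> cs; apply: (@tf_ind_tspan _ _ _ _ (fun c => c - dup_map (dup_symb s c) \in _) _ cs).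
- by rewrite !linear0 addr0 rpred0.
- by move=> d e Hd He; rewrite !linearD addrACA rpredD.
move=> w m rw; rewrite dup_symb_tens rw /=; case: ifPn => nw; last first.
  by rewrite linear0 subr0 tens_tspan // -[rep _ _]negbK.
have [wE _] := dup_rep rw nw.
rewrite dup_map_tens -?wE ?subrr ?rpred0 //.
by case: s w rw {cs nw wE} => [|s] [|x w] //; rewrite rep0.
Qed.

Lemma dup_mapK s g k : g \in tspan (fun k => size k == s) -> ~~ trivial_word k ->
  (dup_symb s (dup_map g))@_k = g@_k.
Proof.
move=> gs kN; apply: (@tf_ind_tspan _ _ _ _
  (fun g => (dup_symb s (dup_map g))@_k = g@_k) _ gs).
- by rewrite !linear0 !mcoeff0.
- by move=> d e Hd He; rewrite !linearD /= !mcoeffD Hd He.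
move=> j l /eqP <-; case: j => [|x j].
  rewrite dup_map_nil linear0 mcoeff0 mcoeff_tens.
  by case: eqP kN => // <-.
elim/tf_ind: l => [|l l' Hl Hl'|u m]; first by rewrite !linear0 !mcoeff0.
  by rewrite !linearD /= !mcoeffD Hl Hl'.
rewrite dup_map_tens // dup_symb_tens rep_dup // rep_pred_dup take_dup drop_dup //=.
case: ifP => [//|/negbFE jD]; rewrite mcoeff0 mcoeff_tens; case: eqP => // kj.
by move: kN; rewrite -kj /trivial_word jD orbT.
Qed.

(** The two faces at the repeated pair cancel, and faces at earlier letters move the pair one place
    toward the start, hence down in the filtration. The remaining faces act on the coefficient, with
    the sign of the s + 1 letters before it. *)
Lemma wdiff_dup s g : g \in tspan (fun k => size k == s) ->
  wdiff (dup_map g) - (-1) ^+ s.-1 *: dup_map (map_coef wdiff g) \in tspan (rep s.-1).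
Proof.
move=> gs; pose f : {linear tensfree C (seq X) -> C} :=
  (wdiff \o dup_map) \- (GRing.scale ((-1) ^+ s.-1) \o (dup_map \o map_coef wdiff)).
apply: (linear_tspan (f := f) gs) => k l /eqP ks.
rewrite /f {f} -{}ks [X in X \in _]/= map_coef_tens.
case: k => [|x k]; first by rewrite !dup_map_nil !linear0 addr0 rpred0.
elim: k x => [|y k IHk] x; rewrite [size _]/= [_.-1]/=.
  by rewrite !dup_map1 expr0 scale1r wdiff_push2 subrr rpred0.
have kl : dup_map (tens (y :: k) l) \in tspan (rep (size k).+1).
  by apply: dup_map_rep; apply: tens_tspan.
rewrite !dup_map_cons wdiff_push exprS mulN1r scaleNr opprK -addrA.
apply: rpredD; first by apply: rpredB => //; apply: word_act_tspan kl => w; apply: rep_map.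
rewrite -rpredN opprD opprK -(linearZZ (push_letter x)) -(linearB (push_letter x)).
by apply: push_letter_tspan (IHk y) => w; apply: rep_cons.
Qed.

(** The differential on the graded pieces of the filtration: replacing [c] by [dup_map g] alters its
    boundary only within [rep s.-1], which [dup_symb s] kills. *)
Lemma dup_symb_wdiff s c : c \in tspan (rep s) ->
  dup_symb s (wdiff c) = (-1) ^+ s.-1 *: map_coef wdiff (dup_symb s c).
Proof.
move=> cs; set g := dup_symb s c.
have gs : g \in tspan (fun k => size k == s).
  by apply: sub_tspan (dup_symb_tspan s c) => k /andP[].
have -> : dup_symb s (wdiff c) = dup_symb s ((-1) ^+ s.-1 *: dup_map (map_coef wdiff g)).
  apply/eqP; rewrite -subr_eq0 -linearB; apply/eqP/dup_symb_low.
  rewrite -[X in X - _](subrK (wdiff (dup_map g))) -addrA rpredD ?wdiff_dup //.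
  by rewrite -linearB wdiff_rep // dup_symbK.
rewrite linearZZ; congr (_ *: _); apply/malgP => k.
have [kT|kN] := boolP (trivial_word k); last by rewrite dup_mapK ?map_coef_tspan.
have /tspanP g0 := dup_symb_tspan s c; have /tspanP h0 := dup_symb_tspan s (dup_map (map_coef wdiff g)).
by rewrite h0 ?kT ?andbF // map_coefE g0 ?kT ?andbF // linear0.
Qed.

End DupMap.

(** * Symbols of cycles and boundaries *)

Lemma sub_sub3 (V : zmodType) (x y z y' z' : V) :
  x - y - z - (x - y' - z') = y' - y - (z - z').
Proof. by rewrite -[x - y - z]addrA -[x - y' - z']addrA -!(opprD y) -!(opprD y') (opprB x) [LHS]addrC addrA subrK opprD addrACA opprB. Qed.

Section Cycles.
Variables (R : comPzRingType) (X : spindleType) (M : lmodType R) (a : action X M).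
Local Notation C := (tensfree M (seq X)).
Local Notation dup_map := (dup_map X M).
Local Notation dup_symb := (dup_symb X M).
Local Notation tdiff := (wdiff (trivial_action X C)).
Local Notation wdiff := (wdiff a).
Implicit Types (c : C) (g : tensfree C (seq X)).

Definition is_boundary c := exists d, wdiff d = c.

Lemma is_boundary_closed : lin_closed is_boundary.
Proof. exact: lin_closed_im. Qed.

(** The differential lowers length by exactly one, so the components of a filling in other lengths
    have total boundary zero and can be projected away. *)
Lemma is_boundary_size p c : is_boundary c -> c \in tspan (fun w => size w == p) ->
  exists2 d, d \in tspan (fun w => size w == p.+1) & wdiff d = c.
Proof.
move=> [d <-] dp; exists (tspan_proj (fun w => size w == p.+1) d); first exact: tspan_proj_tspan.
apply/esym/eqP; rewrite -subr_eq0 -linearB; apply/eqP/tspan0.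
have : wdiff (d - tspan_proj (fun w => size w == p.+1) d) \in tspan (fun w => size w != p).
  apply: (linear_tspan (tspan_proj_predC _ _)) => w m /= wp.
  have := wdiff_size a (tens_tspan m (eqxx (size w) : (fun v => size v == size w) w)).
  by apply: sub_tspan => v /eqP vw; move: wp; rewrite -vw eqSS.
set e := wdiff _ => e1; have : e \in tspan (fun w => size w == p).
  rewrite /e linearB rpredB //.
  by apply: sub_tspan (wdiff_size a (tspan_proj_tspan _ _)) => w; rewrite eqSS.
by move=> e2; apply: (@sub_tspan _ _ _ (fun w => (size w == p) && (size w != p)));
  rewrite ?tspan_and ?e1 ?e2 // => w /andP[->].
Qed.

Lemma word_act_boundary x c : wdiff c = 0 -> is_boundary (c - word_act a x c).
Proof.
by move=> c0; exists (push_letter x c); rewrite wdiff_push c0 linear0 subr0.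
Qed.

(* On cycles [word_act] is homologous to the identity, so [wdiff] induces on
   the symbols of cycles the differential with trivial coefficients. *)
Lemma wdiff_dup_cycle s p g : g \in tspan (fun k => size k == s) ->
  (forall k, g@_k \in tspan (fun u => size u == p)) -> (forall k, wdiff g@_k = 0) ->
  exists t, [/\ t \in tspan (fun k => (size k).+1 == s),
    (forall k, t@_k \in tspan (fun u => size u == p)),
    wdiff (dup_map g) = dup_map t & forall k, is_boundary (t@_k - (tdiff g)@_k)].
Proof.
move=> gs gp g0; have Bcl := is_boundary_closed.
apply: (@tf_ind_coef _ _ _ (fun g => exists t, [/\ t \in tspan (fun k => (size k).+1 == s),
    (forall k, t@_k \in tspan (fun u => size u == p)),
    wdiff (dup_map g) = dup_map t & forall k, is_boundary (t@_k - (tdiff g)@_k)])).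
- exists 0; rewrite !linear0 rpred0; split=> // k; rewrite mcoeff0 ?rpred0 //.
  by rewrite subr0; apply: lin_closed0 Bcl.
- move=> c d [t [ts tp tE tB]] [u [us up uE uB]]; exists (t + u); split.
  + exact: rpredD.
  + by move=> k; rewrite mcoeffD rpredD.
  + by rewrite !linearD /= tE uE.
  by move=> k; rewrite linearD !mcoeffD opprD addrACA; apply: lin_closedD.
move=> k /(allP gs)/eqP <- {gs}; move: g@_k {g0 gp}(g0 k) (gp k) => l l0 lp.
case: k => [|x k].
  exists 0; rewrite rpred0 dup_map_nil wdiff_nil !linear0; split=> // j.
    by rewrite mcoeff0 rpred0.
  by rewrite !mcoeff0 subr0; apply: lin_closed0 Bcl.
(* The induction also keeps [t] away from the empty key, where [dup_map_push] fails. *)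
suff [t [ts tn tp tE tB]] : exists t, [/\ t \in tspan (fun j => (size j).+1 == (size k).+1),
    t \in tspan (predC (@nilp X)),
    (forall k, t@_k \in tspan (fun u => size u == p)),
    wdiff (dup_map (tens (x :: k) l)) = dup_map t &
    forall j, is_boundary (t@_j - (tdiff (tens (x :: k) l))@_j)] by exists t.
elim: k x => [|y k IHk] x; last have [t [ts tn tp tE tB]] := IHk y.
  exists 0; rewrite !rpred0 dup_map1 wdiff_push2 l0 wdiff_cons word_act_tens wdiff_nil.
  rewrite subrr !linear0 /=; split=> // j; first by rewrite mcoeff0 rpred0.
  by rewrite addr0 mcoeff0 subr0; apply: lin_closed0 Bcl.
have tensp j i v : v \in tspan (fun u => size u == p) -> (tens (M := C) j v)@_i \in tspan (fun u => size u == p).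
  by move=> vp; rewrite mcoeff_tens; case: ifP => // _; apply: rpred0.
have lx : word_act a x l \in tspan (fun u => size u == p).
  by apply: word_act_tspan lp => u; rewrite size_map.
(* The exact boundary: the two faces at [x], then the recursive term. The trivial-coefficient
   differential omits the action of [x] on [l], an error that is a boundary by
   [word_act_boundary]. *)
exists (tens (y :: k) l - tens [seq sop z x | z <- y :: k] (word_act a x l)
        - push_letter x t); split.
- rewrite !rpredB ?tens_tspan //= ?size_map //.
  by apply: push_letter_tspan ts => j.
- rewrite !rpredB ?tens_tspan //=.
  by apply: push_letter_tspan tn => j.
- move=> j; rewrite !mcoeffB !rpredB ?tensp //.
  pose W (v : C) := v \in tspan (fun u => size u == p).
  apply: (linear_coef_closed (W := W) (W' := W)) => //; first exact: lin_closed_tspan.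
  by move=> i v vp {}j; rewrite push_letter_tens; apply: tensp.
- by rewrite dup_map_cons wdiff_push tE !linearB /= word_act_dup dup_map_push.
move=> j; rewrite wdiff_cons word_act_tens /= !mcoeffB.
have E1 : is_boundary ((push_letter x t)@_j - (push_letter x (tdiff (tens (y :: k) l)))@_j).
  rewrite -mcoeffB -linearB; apply: (linear_coef_closed (W := is_boundary) (W' := is_boundary)) => //.
    move=> i v vB {}j; rewrite push_letter_tens mcoeff_tens.
    by case: ifP => // _; apply: lin_closed0 Bcl.
  by move=> i; rewrite mcoeffB; apply: tB.
rewrite sub_sub3; apply: lin_closedB => //.
rewrite !mcoeff_tens; case: eqP => _; first exact: word_act_boundary.
by rewrite subrr; apply: lin_closed0 Bcl.
Qed.



(** By [wdiff_dup], filling the coefficients of [g] yields, up to sign, a chain whose boundary has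
    leading term [dup_map g]. Trivial keys need no filling: [dup_map] already sends them into
    [rep s.-1]. *)
Lemma kill_symbol s p g : g \in tspan (fun k => size k == s) ->
  (forall k, g@_k \in tspan (fun u => size u == p)) ->
  (forall k, ~~ trivial_word k -> is_boundary g@_k) ->
  exists c, [/\ c \in tspan (rep s), c \in tspan (fun w => size w == (s + p).+2) &
    dup_map g - wdiff c \in tspan (rep s.-1)].
Proof.
move=> gs gp gB; pose h := tspan_proj (predC (@trivial_word X)) g.
have hs : h \in tspan (fun k => size k == s) by apply: tspan_proj_sub.
have [||e es eh] := @coef_lift R _ C C
    (fun m n => m \in tspan (fun w => size w == p.+1) /\ wdiff m = n) h _ hs.
- by rewrite rpred0 linear0.
- move=> k; rewrite tspan_projE; case: ifP => [/= kN|_].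
    by have [m mp mE] := is_boundary_size (gB k kN) (gp k); exists m.
  by exists 0; rewrite rpred0 linear0.
have {}eE : map_coef wdiff e = h by apply/malgP => k; rewrite map_coefE; case: (eh k).
exists ((-1) ^+ s.-1 *: dup_map e); split.
- by rewrite rpredZ // dup_map_rep.
- by rewrite rpredZ // -addnS; apply: dup_map_size es _ => k; case: (eh k).
have gh : g - h \in tspan (fun k => (size k == s) && trivial_word k).
  rewrite tspan_and rpredB //=; apply: sub_tspan (tspan_proj_predC _ _) => k /=.
  by rewrite negbK.
have -> : dup_map g = dup_map (g - h) + dup_map h by rewrite -linearD subrK.
rewrite -addrA rpredD ?(dup_map_trivial gh) // -rpredN opprB.
have := rpredZ ((-1) ^+ s.-1) (wdiff_dup a es).
by rewrite scalerBr scalerA -expr2 sqrr_sign scale1r eE linearZZ.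
Qed.

(** Converse of [kill_symbol], up to the sign of [c]: the relation is read through [dup_symb s],
    which kills [rep s.-1]. *)
Lemma boundary_symbol s g c : g \in tspan (fun k => size k == s) ->
  c \in tspan (rep s) -> dup_map g + wdiff c \in tspan (rep s.-1) ->
  forall k, ~~ trivial_word k -> is_boundary g@_k.
Proof.
move=> gs cs /dup_symb_low; rewrite linearD /= dup_symb_wdiff // => g0 k kN.
have := congr1 (mcoeff k) g0.
rewrite mcoeff0 mcoeffD dup_mapK // => /eqP; rewrite addr_eq0 => /eqP->.
rewrite Defs.mcoeffZ map_coefE -scaleNr -linearZZ.
by eexists.
Qed.

End Cycles.

(** * Contractions and universal coefficients *)

Section ScaleBy.
Variables (R : comPzRingType) (V : lmodType R).

Definition scale_by (v : V) (r : R^o) : V := r *: v.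

Fact scale_by_is_linear v : linear (scale_by v).
Proof. by move=> r x y; rewrite /scale_by scalerDl scalerA. Qed.
HB.instance Definition _ v := GRing.isLinear.Build R R^o V _ (scale_by v) (scale_by_is_linear v).

Variable K : choiceType.

Definition tens_by (c : tensfree R^o K) (v : V) : tensfree V K := map_coef (scale_by v) c.

Lemma tens_byE c v (k : K) : (tens_by c v)@_k = (c@_k : R) *: v.
Proof. exact: map_coefE. Qed.

Fact tens_by_is_linear c : linear (tens_by c).
Proof.
move=> r u v; apply/malgP => k; rewrite mcoeffD Defs.mcoeffZ !tens_byE.
by rewrite scalerDr !scalerA mulrC.
Qed.
HB.instance Definition _ c := GRing.isLinear.Build R V (tensfree V K) _ (tens_by c) (tens_by_is_linear c).

End ScaleBy.

(** With [H] viewed as an endomorphism of the free module on [K], this is its tensor product with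
    [V]. *)
HB.lock Definition base_change (R : comPzRingType) (K : choiceType) (H : K -> tensfree R^o K)
    (V : lmodType R) : {linear tensfree V K -> tensfree V K} :=
  tf_ext (fun k => tens_by (V := V) (H k)).

Section Contraction.
Variables (R : comPzRingType) (K : choiceType) (deg : K -> nat) (bad : pred K).
Variable d : {linear tensfree R^o K -> tensfree R^o K}.
Implicit Types (H : K -> tensfree R^o K).
Local Notation gen k := (@tens R R^o K k (1 : R)).

Lemma base_change_tens H (V : lmodType R) k v :
  base_change H V (tens k v) = map_coef (scale_by v) (H k).
Proof. by rewrite base_change.unlock; apply: tf_ext_tens. Qed.

Lemma base_change_scale H (V : lmodType R) v c :
  base_change H V (map_coef (scale_by v) c) =
  map_coef (scale_by v) (base_change H R^o c).
Proof.
elim/tf_ind: c => [|c e Hc He|k r]; first by rewrite !linear0.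
  by rewrite !linearD /= Hc He.
rewrite map_coef_tens !base_change_tens; apply/malgP => l.
by rewrite !map_coefE /= /scale_by scalerA.
Qed.

Definition contracts_below n H := forall c, c \in tspan (fun k => deg k < n)%N ->
  c - d (base_change H R^o c) - base_change H R^o (d c) \in tspan bad.

Hypothesis d_deg : forall n c, c \in tspan (fun k => deg k == n) ->
  d c \in tspan (fun k => (deg k).+1 == n).
Hypothesis d_bad : forall c, c \in tspan bad -> d c \in tspan bad.
Hypothesis ddE : forall c, d (d c) = 0.
Hypothesis acyclic : forall n c, c \in tspan (fun k => deg k == n) ->
  d c \in tspan bad -> exists2 b, b \in tspan (fun k => deg k == n.+1) &
  c - d b \in tspan bad.

(** Induction on degree: for a generator k of degree n, the chain k - H (d k) is a cycle modulo bad
    keys, so acyclicity makes it the boundary of some b modulo bad keys, and b becomes the value at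
    k. Freeness allows this choice generator by generator. *)
Lemma contraction n : exists H, [/\ forall k, H k \in tspan (fun l => deg l == (deg k).+1),
  forall k, bad k -> H k = 0 & contracts_below n H].
Proof.
elim: n => [|n [H [Hdeg Hbad Hn]]].
  exists (fun=> 0); split=> // [k|c /tspan0->]; first exact: rpred0.
  by rewrite !linear0 !addr0 rpred0.
have d_lt m (c : tensfree R^o K) : c \in tspan (fun k => deg k == m) ->
    d c \in tspan (fun k => deg k < m)%N.
  by move=> /d_deg; apply: sub_tspan => k /eqP <-.
have /choice[h hE] k : exists b : tensfree R^o K, deg k = n -> ~~ bad k ->
   b \in tspan (fun l => deg l == n.+1) /\
   gen k - base_change H R^o (d (gen k)) - d b \in tspan bad.
  have [/eqP kn|kn] := boolP (deg k == n); last first.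
    by exists 0 => kn'; rewrite kn' eqxx in kn.
  set c := gen k; have cn : c \in tspan (fun k => deg k == n).
    by apply: tens_tspan; rewrite kn.
  have [||b bn bE] := @acyclic n (c - base_change H R^o (d c)).
  - rewrite rpredB //; apply: (linear_tspan (d_deg cn)) => l r /eqP ln.
    by rewrite base_change_tens map_coef_tspan // -ln.
  - rewrite linearB; have := Hn _ (d_lt _ _ cn).
    by rewrite ddE linear0 subr0.
  by exists b.
(* Only good generators of degree n get new values, so the homotopy identity in lower degrees
   survives. *)
pose H' k := if (deg k == n) && ~~ bad k then h k else H k.
have H'E c : c \in tspan (fun k => deg k < n)%N -> base_change H' R^o c = base_change H R^o c.
  move=> cn; apply: (eq_on_tspan cn) => k r kn; rewrite !base_change_tens /H'.
  by rewrite ltn_eqF.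
exists H'; split=> [k|k kb|c cn].
- rewrite /H'; case: ifP => // /andP[/eqP kn kb]; rewrite kn.
  by case: (hE k kn kb).
- by rewrite /H' kb andbF; apply: Hbad.
pose f : {linear tensfree R^o K -> tensfree R^o K} :=
  (idfun \- (d \o base_change H' R^o)) \- (base_change H' R^o \o d).
apply: (linear_tspan (f := f) cn).
move=> k r; rewrite ltnS leq_eqVlt => kn.
have rE : tens k r = r *: gen k by rewrite -linearZZ; congr (tens k _); rewrite /GRing.scale /= mulr1.
suff E : gen k - d (base_change H' R^o (gen k))
    - base_change H' R^o (d (gen k)) \in tspan bad.
  by rewrite rE linearZZ rpredZ.
have one : map_coef (scale_by (1 : R^o)) =1 id :> (tensfree R^o K -> tensfree R^o K).
  by move=> c'; apply/malgP => l; rewrite map_coefE; apply: mulr1.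
have dk : d (gen k) \in tspan (fun l => deg l < deg k)%N.
  by apply/d_lt/tens_tspan.
have [kb|kb] := boolP (bad k).
  have H'0 c' : c' \in tspan bad -> base_change H' R^o c' = 0.
    move=> cb; apply: (@tf_ind_tspan _ _ _ _ (fun c => base_change H' R^o c = 0) c' cb).
    - by rewrite linear0.
    - by move=> u v Hu Hv; rewrite linearD /= Hu Hv addr0.
    by move=> l s lb; rewrite base_change_tens /H' lb andbF Hbad // linear0.
  rewrite H'0 ?tens_tspan // linear0 subr0 H'0 ?subr0 ?tens_tspan //.
  by apply/d_bad/tens_tspan.
case/orP: kn => kn.
  rewrite base_change_tens one H'E ?(eqP kn) //; last by rewrite -(eqP kn).
  have [_] := hE k (eqP kn) kb; rewrite /H' kn kb /=.
  by rewrite addrAC.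
rewrite !H'E ?tens_tspan //; last by apply: sub_tspan dk => l /ltn_trans; apply.
by apply: Hn; apply: tens_tspan.
Qed.

Variables (V : lmodType R) (dV : {linear tensfree V K -> tensfree V K}).
Hypothesis dV_scale : forall v c, dV (map_coef (scale_by v) c) = map_coef (scale_by v) (d c).

(* An acyclic complex of free modules that is bounded below is contractible,
   hence remains acyclic with coefficients in any module; [U] stands for the
   submodule by which the coefficients are reduced. *)
Lemma universal_coefficients n (U : V -> Prop) c : lin_closed U ->
  c \in tspan (fun k => deg k == n) -> (forall k, ~~ bad k -> U (dV c)@_k) ->
  exists b, [/\ b \in tspan (fun k => deg k == n.+1),
    forall W : V -> Prop, lin_closed W -> (forall k, W c@_k) -> forall k, W b@_k &
    forall k, ~~ bad k -> U (c@_k - (dV b)@_k)].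
Proof.
move=> Ulin cn dcU; have [H [Hdeg Hbad Hn]] := contraction n.+1.
have hdeg : base_change H V c \in tspan (fun k => deg k == n.+1).
  by apply: (linear_tspan cn) => k v /eqP <-; rewrite base_change_tens map_coef_tspan.
exists (base_change H V c); split=> // [W Wlin cW|k kb].
  apply: (linear_coef_closed (W := W) (W' := W)) => // k v vW l.
  by rewrite base_change_tens map_coefE; apply: lin_closedZ.
have E : c - dV (base_change H V c) - base_change H V (dV c) \in tspan bad.
  pose f : {linear tensfree V K -> tensfree V K} :=
    (idfun \- (dV \o base_change H V)) \- (base_change H V \o dV).
  apply: (linear_tspan (f := f) cn) => l v /eqP ln; rewrite /f /=.
  have -> : tens l v = map_coef (scale_by v) (gen l).
    by rewrite map_coef_tens; congr (tens l _); apply/esym/scale1r.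
  rewrite dV_scale !base_change_scale dV_scale -!linearB /=.
  by apply/map_coef_tspan/Hn/tens_tspan; rewrite ln.
have /tspanP/(_ k kb)/eqP := E; rewrite mcoeffB subr_eq0 mcoeffB => /eqP->.
(* Modulo bad keys the defect of the filling is [H] applied to [dV c]. As [H] vanishes on bad keys,
   only coefficients at good keys contribute, and these lie in [U]. *)
set e := dV c in dcU *; rewrite [e]tensE linear_sum (raddf_sum (mcoeff k)).
apply: lin_closed_sum => // l; rewrite /= base_change_tens.
have [/Hbad->|/dcU lU] := boolP (bad l).
  by rewrite linear0 mcoeff0; apply: lin_closed0 Ulin.
by rewrite map_coefE; apply: lin_closedZ.
Qed.

End Contraction.

(** * Relabelling of generators and functoriality *)

HB.lock Definition key_map (R : pzRingType) (K K' : choiceType) (f : K -> K') (V : lmodType R) :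
    {linear tensfree V K -> tensfree V K'} := tf_ext (fun k => tens (f k)).

Arguments key_map {R K K'} f {V}.

Section KeyMap.
Variables (R : pzRingType) (K K' : choiceType) (f : K -> K').

Lemma key_map_tens (V : lmodType R) k v : key_map f (tens k v) = tens (f k) v :> tensfree V K'.
Proof. by rewrite key_map.unlock; apply: tf_ext_tens. Qed.

Lemma key_map_tspan (V : lmodType R) (P : pred K) (Q : pred K') (c : tensfree V K) :
  (forall k, P k -> Q (f k)) -> c \in tspan P -> key_map f c \in tspan Q.
Proof.
by move=> PQ cP; apply: (linear_tspan cP) => k v /PQ; rewrite key_map_tens; apply: tens_tspan.
Qed.

Lemma key_map_coef (V W : lmodType R) (g : {linear V -> W}) (c : tensfree V K) :
  key_map f (map_coef g c) = map_coef g (key_map f c).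
Proof.
elim/tf_ind: c => [|c d Hc Hd|k v]; first by rewrite !linear0.
  by rewrite !linearD /= Hc Hd.
by rewrite key_map_tens !map_coef_tens key_map_tens.
Qed.

Lemma key_map_closed (V : lmodType R) (W : V -> Prop) (c : tensfree V K) : lin_closed W ->
  (forall k, W c@_k) -> forall k, W (key_map f c)@_k.
Proof.
move=> Wlin; apply: linear_coef_closed => // k v Wv l.
by rewrite key_map_tens mcoeff_tens; case: ifP => // _; apply: lin_closed0 Wlin.
Qed.

Lemma key_map_inj (V : lmodType R) k (c : tensfree V K) : injective f ->
  (key_map f c)@_(f k) = c@_k.
Proof.
move=> f_inj; elim/tf_ind: c => [|c d Hc Hd|l v]; first by rewrite linear0 !mcoeff0.
  by rewrite linearD !mcoeffD Hc Hd.
by rewrite key_map_tens !mcoeff_tens (inj_eq f_inj).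
Qed.

Lemma key_map_out (V : lmodType R) l (c : tensfree V K) : (forall k, f k != l) ->
  (key_map f c)@_l = 0.
Proof.
move=> fl; elim/tf_ind: c => [|c d Hc Hd|k v]; first by rewrite linear0 !mcoeff0.
  by rewrite linearD !mcoeffD Hc Hd addr0.
by rewrite key_map_tens !mcoeff_tens (negbTE (fl k)).
Qed.

End KeyMap.

Section TrivialCoefficients.
Variables (R : comPzRingType) (X : spindleType).
Local Notation tdiff V := (wdiff (trivial_action X V)).

(** A trivial action never touches the coefficients, so any linear map of coefficients is a chain
    map. *)
Lemma map_coef_tdiff (V W : lmodType R) (g : {linear V -> W}) c :
  map_coef g (tdiff V c) = tdiff W (map_coef g c).
Proof.
elim/tf_ind: c => [|c d Hc Hd|k v]; first by rewrite !linear0.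
  by rewrite !linearD /= Hc Hd.
elim: k => [|x k IHk]; first by rewrite map_coef_tens !wdiff_nil linear0.
rewrite map_coef_tens !wdiff_cons !linearB /= !word_act_tens !map_coef_tens.
rewrite -map_coef_tens -IHk; congr (_ - _).
move: (tdiff V _) => c; elim/tf_ind: c => [|c d Hc Hd|l u]; first by rewrite !linear0.
  by rewrite !linearD /= Hc Hd.
by rewrite !(push_letter_tens, map_coef_tens).
Qed.

Lemma tdiff_closed (V : lmodType R) (W : V -> Prop) c : lin_closed W ->
  (forall k, W c@_k) -> forall k, W (tdiff V c)@_k.
Proof.
move=> Wlin; apply: linear_coef_closed => // k v Wv.
have tensW j i : W (tens (M := V) (K := seq X) j v)@_i.
  by rewrite mcoeff_tens; case: ifP => // _; apply: lin_closed0 Wlin.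
elim: k => [|x k IHk] l; first by rewrite wdiff_nil mcoeff0; apply: lin_closed0 Wlin.
rewrite wdiff_cons !mcoeffB word_act_tens.
apply: lin_closedB => //; first exact: lin_closedB.
move: l; apply: (linear_coef_closed (W := W) (W' := W)) => // i u uW l.
by rewrite push_letter_tens mcoeff_tens; case: ifP => // _; apply: lin_closed0 Wlin.
Qed.

End TrivialCoefficients.

Section PushWord.
Variables (R : comPzRingType) (X X' : spindleType) (phi : spindle_hom X X').
Variables (M : lmodType R) (a : action X M) (a' : action X' M).
Hypothesis aa' : compatible phi a a'.
Local Notation push := (key_map (map phi)).

Lemma push_push_letter (V : lmodType R) x (c : tensfree V (seq X)) :
  push (push_letter x c) = push_letter (phi x) (push c).
Proof.
elim/tf_ind: c => [|c d Hc Hd|w m]; first by rewrite !linear0.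
  by rewrite !linearD /= Hc Hd.
by rewrite !(push_letter_tens, key_map_tens).
Qed.

Lemma push_word_act x c : push (word_act a x c) = word_act a' (phi x) (push c).
Proof.
elim/tf_ind: c => [|c d Hc Hd|w m]; first by rewrite !linear0.
  by rewrite !linearD /= Hc Hd.
rewrite !(word_act_tens, key_map_tens) aa' -!map_comp; congr (tens _ _).
by apply: eq_map => y /=; rewrite shomM.
Qed.

Lemma push_wdiff c : push (wdiff a c) = wdiff a' (push c).
Proof.
elim/tf_ind: c => [|c d Hc Hd|w m]; first by rewrite !linear0.
  by rewrite !linearD /= Hc Hd.
elim: w => [|x w IHw]; first by rewrite key_map_tens !wdiff_nil linear0.
rewrite key_map_tens !wdiff_cons !linearB /= push_word_act push_push_letter IHw.
by rewrite !key_map_tens.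
Qed.

Lemma push_dup_map g :
  push (dup_map X M g) = dup_map X' M (push (map_coef push g)).
Proof.
elim/tf_ind: g => [|c d Hc Hd|k l]; first by rewrite !linear0.
  by rewrite !linearD /= Hc Hd.
rewrite map_coef_tens key_map_tens; case: k => [|x k]; first by rewrite !dup_map_nil linear0.
elim: k x => [|y k IHk] x; first by rewrite !dup_map1 !push_push_letter.
by rewrite dup_map_cons push_push_letter IHk dup_map_cons.
Qed.

Lemma push_rep (V : lmodType R) s (c : tensfree V (seq X)) :
  c \in tspan (rep s) -> push c \in tspan (@rep X' s).
Proof. by apply: key_map_tspan => w; apply: rep_map. Qed.

Lemma push_size (V : lmodType R) p (c : tensfree V (seq X)) :
  c \in tspan (fun w => size w == p) -> push c \in tspan (fun w => size w == p).
Proof. by apply: key_map_tspan => w; rewrite size_map. Qed.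

Lemma push_boundary c : is_boundary a c -> is_boundary a' (push c).
Proof. by case=> d <-; exists (push d); rewrite push_wdiff. Qed.

End PushWord.

Lemma trivial_word_map (X X' : eqType) (f : X -> X') w :
  trivial_word w -> trivial_word (map f w).
Proof.
rewrite /trivial_word /nilp size_map => /orP[->//|wD].
by rewrite [degen _](@rep_degen _ (size w)) ?orbT // rep_map.
Qed.

Lemma wdiff_trivial_word (R : comPzRingType) (X : spindleType) (M : lmodType R)
    (a : action X M) c :
  c \in tspan (@trivial_word X) -> wdiff a c \in tspan (@trivial_word X).
Proof.
move=> cT; apply: (linear_tspan cT) => w m /orP[/nilP->|wD]; first by rewrite wdiff_nil rpred0.
have := wdiff_degen a (tens_tspan m wD); apply: sub_tspan => v.
by rewrite /trivial_word => ->; rewrite orbT.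
Qed.

Lemma wdiff_sizeS (R : comPzRingType) (X : spindleType) (M : lmodType R)
    (a : action X M) n c : c \in tspan (fun w => (size w).+1 == n) ->
  wdiff a c \in tspan (fun w => (size w).+2 == n).
Proof.
case: n => [|n] cn; last exact: wdiff_size.
by rewrite (tspan0 cn) linear0 rpred0.
Qed.

(** * Mapping cones and their coefficients *)

Section Cones.
Variables (R : comPzRingType) (X X' : spindleType) (phi : spindle_hom X X').
Local Notation push := (key_map (map phi)).

(* A chain of degree [n] of the mapping cone of [push] is a pair [(x, y)], with
   differential [(x, y) |-> (- d x, push x + d y)]. *)
Section Acyclicity.
Variables (M : lmodType R) (a : action X M) (a' : action X' M).

Definition cone_acyclic n := forall (x : tensfree M (seq X)) (y : tensfree M (seq X')),
  x \in tspan (fun w => (size w).+1 == n) -> y \in tspan (fun w => size w == n) ->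
  wdiff a x = 0 -> push x + wdiff a' y = 0 ->
  exists x2 y2, [/\ x2 \in tspan (fun w => size w == n), y2 \in tspan (fun w => size w == n.+1),
    x + wdiff a x2 = 0 & y - push x2 - wdiff a' y2 = 0].

Definition degenerate_cone_acyclic n := forall (x : tensfree M (seq X)) (y : tensfree M (seq X')),
  x \in tspan (@degen X) -> y \in tspan (@degen X') ->
  x \in tspan (fun w => (size w).+1 == n) -> y \in tspan (fun w => size w == n) ->
  wdiff a x = 0 -> push x + wdiff a' y = 0 ->
  exists x2 y2, [/\ x2 \in tspan (@degen X), y2 \in tspan (@degen X'),
    x2 \in tspan (fun w => size w == n), y2 \in tspan (fun w => size w == n.+1) &
    x + wdiff a x2 = 0 /\ y - push x2 - wdiff a' y2 = 0].

(** The quotient is expressed through representatives; discarding empty words as well removes the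
    augmentation. *)
Definition normalized_cone_acyclic n := forall (x : tensfree M (seq X)) (y : tensfree M (seq X')),
  x \in tspan (fun w => (size w).+1 == n) -> y \in tspan (fun w => size w == n) ->
  wdiff a x \in tspan (@trivial_word X) ->
  push x + wdiff a' y \in tspan (@trivial_word X') ->
  exists x2 y2, [/\ x2 \in tspan (fun w => size w == n), y2 \in tspan (fun w => size w == n.+1),
    x + wdiff a x2 \in tspan (@trivial_word X) &
    y - push x2 - wdiff a' y2 \in tspan (@trivial_word X')].

End Acyclicity.

Hypothesis normR : forall n, normalized_cone_acyclic (trivial_action X R^o) (trivial_action X' R^o) n.

Section ConeCoefficients.
Variable V : lmodType R.
Local Notation J := (seq X + seq X')%type.
Local Notation cone := (tensfree V J).
Local Notation td := (wdiff (trivial_action X V)).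
Local Notation td' := (wdiff (trivial_action X' V)).

Definition cone_left : {linear cone -> tensfree V (seq X)} :=
  tf_ext (fun j => if j is inl w then tens w : {linear _ -> _} else \0).

Definition cone_right : {linear cone -> tensfree V (seq X')} :=
  tf_ext (fun j => if j is inr w then tens w : {linear _ -> _} else \0).

Lemma cone_leftE c w : (cone_left c)@_w = c@_(inl w : J).
Proof.
elim/tf_ind: c => [|c d Hc Hd|j v]; first by rewrite linear0 !mcoeff0.
  by rewrite linearD !mcoeffD Hc Hd.
rewrite [cone_left _]tf_ext_tens mcoeff_tens; case: j => j /=; last by rewrite mcoeff0.
by rewrite mcoeff_tens (inj_eq (@inl_inj _ _)).
Qed.

Lemma cone_rightE c w : (cone_right c)@_w = c@_(inr w : J).
Proof.
elim/tf_ind: c => [|c d Hc Hd|j v]; first by rewrite linear0 !mcoeff0.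
  by rewrite linearD !mcoeffD Hc Hd.
rewrite [cone_right _]tf_ext_tens mcoeff_tens; case: j => j /=; first by rewrite mcoeff0.
by rewrite mcoeff_tens (inj_eq (@inr_inj _ _)).
Qed.

Definition cone_pair (x : tensfree V (seq X)) (y : tensfree V (seq X')) : cone :=
  key_map inl x + key_map inr y.

Lemma cone_pair_inl x y w : (cone_pair x y)@_(inl w : J) = x@_w.
Proof.
rewrite mcoeffD (key_map_inj _ _ (@inl_inj _ _)) (key_map_out (f := inr)) ?addr0 //.
Qed.

Lemma cone_pair_inr x y w : (cone_pair x y)@_(inr w : J) = y@_w.
Proof.
rewrite mcoeffD (key_map_inj _ _ (@inr_inj _ _)) (key_map_out (f := inl)) ?add0r //.
Qed.

(** The cone is a single free module on the disjoint union of the two sets of words, so that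
    [universal_coefficients] applies to it. *)
Definition cone_diff : {linear cone -> cone} :=
  (key_map inr \o ((push \o cone_left) \+ (td' \o cone_right))) \- (key_map inl \o (td \o cone_left)).

Lemma cone_diffE c : cone_diff c =
  cone_pair (- td (cone_left c)) (push (cone_left c) + td' (cone_right c)).
Proof. by rewrite /cone_pair linearN addrC. Qed.

End ConeCoefficients.

Lemma map_coef_cone_diff (V W : lmodType R) (g : {linear V -> W}) c :
  map_coef g (cone_diff V c) = cone_diff W (map_coef g c).
Proof.
have lE : cone_left W (map_coef g c) = map_coef g (cone_left V c).
  by apply/malgP => w; rewrite cone_leftE !map_coefE cone_leftE.
have rE : cone_right W (map_coef g c) = map_coef g (cone_right V c).
  by apply/malgP => w; rewrite cone_rightE !map_coefE cone_rightE.
rewrite !cone_diffE lE rE /cone_pair linearD -!key_map_coef !(linearD, linearN) /=.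
by rewrite !map_coef_tdiff -key_map_coef.
Qed.

Definition cone_deg (j : seq X + seq X') := match j with inl w => (size w).+1 | inr w => size w end.

Definition cone_trivial (j : seq X + seq X') :=
  match j with inl w => trivial_word w | inr w => trivial_word w end.

Lemma cone_pair_tspan (V : lmodType R) (P : pred (seq X + seq X')) x y :
  x \in tspan (P \o inl) -> y \in tspan (P \o inr) -> cone_pair (V := V) x y \in tspan P.
Proof. by move=> xP yP; rewrite rpredD //; [apply: key_map_tspan xP | apply: key_map_tspan yP]. Qed.

Lemma cone_left_tspan (V : lmodType R) (P : pred (seq X + seq X')) c :
  c \in tspan P -> cone_left V c \in tspan (P \o inl).
Proof. by move=> /tspanP cP; apply/tspanP => w wP; rewrite cone_leftE cP. Qed.

Lemma cone_right_tspan (V : lmodType R) (P : pred (seq X + seq X')) c :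
  c \in tspan P -> cone_right V c \in tspan (P \o inr).
Proof. by move=> /tspanP cP; apply/tspanP => w wP; rewrite cone_rightE cP. Qed.

(** Acyclicity over [R] is [normR]. The clause on [W] keeps the solution inside any submodule
    containing the coefficients of the data; it serves to keep them cycles of a given length. *)
Lemma cone_universal (V : lmodType R) (U : V -> Prop) n x y : lin_closed U ->
  x \in tspan (fun w => (size w).+1 == n) -> y \in tspan (fun w => size w == n) ->
  (forall k, ~~ trivial_word k -> U (wdiff (trivial_action X V) x)@_k) ->
  (forall k, ~~ trivial_word k -> U (push x + wdiff (trivial_action X' V) y)@_k) ->
  exists x2 y2, [/\ x2 \in tspan (fun w => size w == n), y2 \in tspan (fun w => size w == n.+1),
    forall W : V -> Prop, lin_closed W -> (forall k, W x@_k) -> (forall k, W y@_k) ->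
      (forall k, W x2@_k) /\ (forall k, W y2@_k),
    forall k, ~~ trivial_word k -> U (x + wdiff (trivial_action X V) x2)@_k &
    forall k, ~~ trivial_word k -> U (y - push x2 - wdiff (trivial_action X' V) y2)@_k].
Proof.
move=> Ulin xn yn xU yU.
have leftK (W : lmodType R) u v : cone_left W (cone_pair u v) = u.
  by apply/malgP => k; rewrite cone_leftE cone_pair_inl.
have rightK (W : lmodType R) u v : cone_right W (cone_pair u v) = v.
  by apply/malgP => k; rewrite cone_rightE cone_pair_inr.
have pairK (W : lmodType R) (c : tensfree W _) : cone_pair (cone_left W c) (cone_right W c) = c.
  apply/malgP => -[w|w]; first by rewrite cone_pair_inl cone_leftE.
  by rewrite cone_pair_inr cone_rightE.
have d_deg m c : c \in tspan (fun j => cone_deg j == m) ->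
    cone_diff R^o c \in tspan (fun j => (cone_deg j).+1 == m).
  move=> cm; rewrite cone_diffE; apply: cone_pair_tspan.
    by rewrite rpredN; apply: wdiff_sizeS; apply: cone_left_tspan cm.
  apply: rpredD; first by apply: key_map_tspan (cone_left_tspan cm) => w; rewrite /= size_map.
  by apply: wdiff_size; apply: cone_right_tspan cm.
have d_triv c : c \in tspan cone_trivial -> cone_diff R^o c \in tspan cone_trivial.
  move=> cT; rewrite cone_diffE; apply: cone_pair_tspan.
    by rewrite rpredN; apply/wdiff_trivial_word/(cone_left_tspan cT).
  apply: rpredD; first by apply: key_map_tspan (cone_left_tspan cT) => w /=; apply: trivial_word_map.
  by apply/wdiff_trivial_word/(cone_right_tspan cT).
have ddE c : cone_diff R^o (cone_diff R^o c) = 0.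
  rewrite !cone_diffE leftK rightK linearN linearD /= !wdiffK oppr0 addr0 linearN.
  rewrite (push_wdiff (a' := trivial_action X' R^o)) // addNr /cone_pair !linear0.
  exact: addr0.
have acyc m c : c \in tspan (fun j => cone_deg j == m) ->
    cone_diff R^o c \in tspan cone_trivial ->
    exists2 b, b \in tspan (fun j => cone_deg j == m.+1) &
      c - cone_diff R^o b \in tspan cone_trivial.
  move=> cm; rewrite cone_diffE => dc.
  have [||||u [v [um vm uT vT]]] := normR (n := m) (x := cone_left _ c) (y := cone_right _ c).
  - exact: cone_left_tspan cm.
  - exact: cone_right_tspan cm.
  - by rewrite -rpredN; have := cone_left_tspan dc; rewrite leftK.
  - by have := cone_right_tspan dc; rewrite rightK.
  exists (cone_pair u v); first exact: cone_pair_tspan.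
  have -> : c - cone_diff R^o (cone_pair u v) = cone_pair
      (cone_left _ c + wdiff (trivial_action X R^o) u)
      (cone_right _ c - push u - wdiff (trivial_action X' R^o) v).
    rewrite cone_diffE leftK rightK -[in LHS](pairK _ c); apply/malgP => -[k|k].
      by rewrite mcoeffB !cone_pair_inl mcoeffN opprK mcoeffD.
    by rewrite mcoeffB !cone_pair_inr mcoeffD opprD addrA !mcoeffB.
  exact: cone_pair_tspan.
have dV v c : cone_diff V (map_coef (scale_by v) c) = map_coef (scale_by v) (cone_diff R^o c).
  by rewrite map_coef_cone_diff.
have [||b [bn bW bU]] := universal_coefficients d_deg d_triv ddE acyc dV (n := n) (c := cone_pair x y) Ulin.
- exact: cone_pair_tspan.
- move=> [k|k] kN; rewrite cone_diffE leftK ?rightK ?cone_pair_inl ?cone_pair_inr; last exact: yU.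
  by rewrite mcoeffN; apply: lin_closedN => //; apply: xU.
exists (cone_left _ b), (cone_right _ b); split.
- exact: cone_left_tspan bn.
- exact: cone_right_tspan bn.
- move=> W Wlin xW yW; have {}bW := bW W Wlin.
  by split=> k; rewrite ?cone_leftE ?cone_rightE; apply: bW => -[j|j];
     rewrite ?cone_pair_inl ?cone_pair_inr.
- move=> k kN; have := bU (inl k) kN; rewrite cone_diffE !cone_pair_inl.
  by rewrite mcoeffN opprK mcoeffD.
move=> k kN; have := bU (inr k) kN; rewrite cone_diffE !cone_pair_inr.
by rewrite mcoeffD opprD addrA !mcoeffB.
Qed.

End Cones.

Lemma dup_symb_cycle (R : comPzRingType) (X : spindleType) (M : lmodType R) (a : action X M)
    s c : c \in tspan (rep s) -> wdiff a c \in tspan (rep s.-1) ->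
  forall k, wdiff a (dup_symb X M s c)@_k = 0.
Proof.
move=> cs /dup_symb_low; rewrite dup_symb_wdiff // => s0 k.
have {}s0 : map_coef (wdiff a) (dup_symb X M s c) = 0.
  by rewrite -[LHS]scale1r -(sqrr_sign R s.-1) expr2 -scalerA s0 scaler0.
by rewrite -map_coefE s0 mcoeff0.
Qed.

(** * Descent along the filtration *)

Section Comparison.
Variables (R : comPzRingType) (X X' : spindleType) (phi : spindle_hom X X').
Variables (M : lmodType R) (a : action X M) (a' : action X' M).
Hypothesis aa' : compatible phi a a'.
Hypothesis normR : forall n,
  normalized_cone_acyclic phi (trivial_action X R^o) (trivial_action X' R^o) n.
Local Notation push := (key_map (map phi)).
Local Notation dX := (wdiff a).
Local Notation dX' := (wdiff a').
Local Notation zX := (dup_map X M).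
Local Notation zX' := (dup_map X' M).

(* The associated graded of the filtration by [rep], where the source of the
   cone is shifted by one so that [push] becomes part of the differential on
   symbols: its homology is that of the cone on normalized chains of the
   spindles, with coefficients in the homology of [tensfree M (seq X')]. *)
Lemma lower_symbol t p x y :
  (forall n, (n <= p.+1)%N -> cone_acyclic phi a a' n) ->
  x \in tspan (rep t) -> y \in tspan (rep t.+1) ->
  x \in tspan (fun w => size w == (t + p).+1) ->
  y \in tspan (fun w => size w == (t.+1 + p).+1) ->
  dX x = 0 -> push x + dX' y = 0 ->
  exists x2 y2, [/\ x2 \in tspan (@degen X) /\ y2 \in tspan (@degen X'),
    x2 \in tspan (fun w => size w == (t.+1 + p).+1),
    y2 \in tspan (fun w => size w == (t.+1 + p).+2),
    x + dX x2 \in tspan (rep t.-1) & y - push x2 - dX' y2 \in tspan (rep t)].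
Proof.
move=> acyc xt yt xp yp dx dxy.
have Bl := @is_boundary_closed _ _ _ a; have Bl' := @is_boundary_closed _ _ _ a'.
pose al := dup_symb X M t x; pose be := dup_symb X' M t.+1 y.
have al_t : al \in tspan (fun k => size k == t).
  by apply: sub_tspan (dup_symb_tspan t x) => k /andP[].
have be_t : be \in tspan (fun k => size k == t.+1).
  by apply: sub_tspan (dup_symb_tspan t.+1 y) => k /andP[].
have al_p := dup_symb_size xp; have be_p := dup_symb_size yp.
have al0 : forall k, dX al@_k = 0 by apply: dup_symb_cycle => //; rewrite dx rpred0.
have be0 : forall k, dX' be@_k = 0.
  apply: dup_symb_cycle => //=; rewrite -(addKr (push x) (dX' y)) dxy addr0 rpredN.
  exact: push_rep.
have [ta [ta_t ta_p ta_d ta_B]] := wdiff_dup_cycle al_t al_p al0.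
have [tb [tb_t tb_p tb_d tb_B]] := wdiff_dup_cycle be_t be_p be0.
have x'_t := dup_symbK xt; have y'_t := dup_symbK yt.
set x' := x - _ in x'_t; set y' := y - _ in y'_t.
have xE : x = x' + zX al by rewrite subrK.
have yE : y = y' + zX' be by rewrite subrK.
(* As [x] is a cycle, [zX ta] cancels against the boundary of [x'], so [boundary_symbol] makes the
   coefficients of [ta] boundaries. Those of the trivial-coefficient differential of [al] follow. *)
have dal_B k : ~~ trivial_word k -> is_boundary a (wdiff (trivial_action X _) al)@_k.
  move=> kN; rewrite -[_@_k](subKr ta@_k); apply: lin_closedB => //.
  apply: (boundary_symbol (s := t.-1) _ x'_t) => //.
    by apply: sub_tspan ta_t => j /eqP <-.
  by rewrite -ta_d addrC -linearD -xE dx rpred0.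
pose al' := map_coef push al : tensfree (tensfree M (seq X')) (seq X).
have pal_t : push al' \in tspan (fun k => size k == t).
  by apply/push_size/map_coef_tspan.
(* Since [y] has boundary [- push x] and [x] lies one filtration step lower, [push al'] enters at
   the same order as [tb]. *)
have dbe_B k : ~~ trivial_word k ->
    is_boundary a' (push al' + wdiff (trivial_action X' _) be)@_k.
  move=> kN; rewrite mcoeffD -[X in _ + X](subKr tb@_k) addrA -mcoeffD.
  apply: lin_closedB => //.
  apply: (boundary_symbol (s := t) _ y'_t) => //.
    by rewrite rpredD.
  rewrite linearD -tb_d -(push_dup_map phi) -addrA -linearD [zX' be + _]addrC -yE.
  have -> : push (zX al) + dX' y = - push x'.
    by apply/eqP; rewrite -addr_eq0 addrAC -linearD [zX al + _]addrC -xE dxy.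
  by rewrite rpredN push_rep.
have dal'_B k : ~~ trivial_word k -> is_boundary a' (wdiff (trivial_action X _) al')@_k.
  move=> /dal_B; rewrite -map_coef_tdiff map_coefE; exact: push_boundary.
have al'_t : al' \in tspan (fun k => (size k).+1 == t.+1) by apply: map_coef_tspan.
(* Modulo boundaries in the coefficients, the pair of [al'] and [be] is a cycle of the
   trivial-coefficient cone, hence filled by [al2] and [be2]. *)
have [al2 [be2 [al2_t be2_t W2 al2_B be2_B]]] :=
  cone_universal normR Bl' al'_t be_t dal'_B dbe_B.
pose W (v : tensfree M (seq X')) := v \in tspan (fun w => size w == p) /\ dX' v = 0.
have Wl : lin_closed W.
  split=> [|r u v [up u0] [vp v0]]; first by split; rewrite ?rpred0 ?linear0.
  by split; rewrite ?rpredD ?rpredZ // linearP /= u0 v0 scaler0 addr0.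
have [||al2_W be2_W] := W2 W Wl.
- move=> k; rewrite map_coefE; split; first exact/push_size/al_p.
  by rewrite -(push_wdiff aa') al0 linear0.
- by move=> k; split; [apply: be_p | apply: be0].
(* Surjectivity on homology of the coefficients: the cone in degree p, with zero source component,
   makes each coefficient of [al2] homologous to the image of a source cycle. *)
have [||ah ah_t ahP] := @coef_lift R _ (tensfree M (seq X)) _
  (fun m n => [/\ m \in tspan (fun w => size w == p), dX m = 0 &
     is_boundary a' (n - push m)]) al2 _ al2_t.
- by rewrite rpred0 !linear0 addr0; split=> //; apply: lin_closed0 Bl'.
- move=> k; have [kp k0] := al2_W k.
  have [||||u [v [up vp u0 v0]]] := acyc p (leqnSn p) 0 al2@_k.
  + exact: rpred0.
  + exact: kp.
  + exact: linear0.
  + by rewrite linear0 add0r.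
  exists u; split=> //; first by rewrite -u0 add0r.
  by exists v; apply/esym/eqP; rewrite -subr_eq0 v0.
have ah_p k : ah@_k \in tspan (fun w => size w == p) by case: (ahP k).
have ah0 k : dX ah@_k = 0 by case: (ahP k).
have ah_B k : is_boundary a' (al2@_k - push ah@_k) by case: (ahP k).
have [si [si_t si_p si_d si_B]] := wdiff_dup_cycle ah_t ah_p ah0.
have be2_p k : be2@_k \in tspan (fun w => size w == p) by case: (be2_W k).
have be20 k : dX' be2@_k = 0 by case: (be2_W k).
have [sb [sb_t sb_p sb_d sb_B]] := wdiff_dup_cycle be2_t be2_p be20.
have diff_B : forall k, is_boundary a' (al2 - map_coef push ah)@_k.
  by move=> k; rewrite mcoeffB map_coefE.
(* [al + si] represents the symbol of [x] plus the boundary of [zX ah]. Its coefficients are cycles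
   whose images bound, so they bound by injectivity on homology, that is, by the cone in degree p +
   1. *)
have rho_B k : ~~ trivial_word k -> is_boundary a (al + si)@_k.
  move=> kN.
  have r0 : dX (al + si)@_k = 0.
    rewrite mcoeffD linearD /= al0 add0r.
    have [e eE] := si_B k; have := wdiffK a e; rewrite eE linearB /=.
    rewrite -[X in _ - X](map_coefE (K := seq X)) map_coef_tdiff.
    have -> : map_coef dX ah = 0 by apply/malgP => j; rewrite map_coefE ah0 mcoeff0.
    by rewrite linear0 mcoeff0 subr0.
  have r_p : (al + si)@_k \in tspan (fun w => size w == p) by rewrite mcoeffD rpredD.
  have r_B : is_boundary a' (push (al + si)@_k).
    have -> : push (al + si)@_k =
        (al' + wdiff (trivial_action X _) al2)@_k
        - (wdiff (trivial_action X _) (al2 - map_coef push ah))@_k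
        + push (si@_k - (wdiff (trivial_action X _) ah)@_k).
      have zE (V : zmodType) (u s d e : V) : u + s = u + d - (d - e) + (s - e).
        by rewrite -[u + d - _]addrA subKr addrACA subrr addr0.
      rewrite !mcoeffD linearD linearB /= [push (_ - _)]linearB /= mcoeffB.
      rewrite -!map_coef_tdiff !map_coefE /=; exact: zE.
    apply: lin_closedD => //; last by apply/(push_boundary aa')/si_B.
    by apply: lin_closedB; [| apply: al2_B | apply: tdiff_closed].
  have [z zp zE] := is_boundary_size r_B (push_size _ r_p).
  have [||||u [v [up vp u0 v0]]] := acyc p.+1 (leqnn _) (al + si)@_k (- z).
  - exact: r_p.
  - by rewrite rpredN.
  - exact: r0.
  - by rewrite linearN /= zE subrr.
  by exists (- u); rewrite linearN; apply/eqP; rewrite eq_sym -addr_eq0 u0.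
have rho_t : al + si \in tspan (fun k => size k == t) by rewrite rpredD.
have rho_p k : (al + si)@_k \in tspan (fun w => size w == p) by rewrite mcoeffD rpredD.
have [c [c_t c_p cE]] := kill_symbol rho_t rho_p rho_B.
pose pah := push (map_coef push ah) : tensfree (tensfree M (seq X')) (seq X').
(* Represents the symbol of [y] after subtraction of [push (zX ah)] and [dX' (zX' be2)]. *)
pose rho' := be - pah - sb.
have rho'_t : rho' \in tspan (fun k => size k == t.+1).
  by rewrite !rpredB //; apply/push_size/map_coef_tspan.
have rho'_p k : rho'@_k \in tspan (fun w => size w == p).
  rewrite !mcoeffB !rpredB //.
  pose Wp (v : tensfree M (seq X')) := v \in tspan (fun u => size u == p).
  apply: (@key_map_closed _ _ _ (map phi) _ Wp) => [|j]; first exact: lin_closed_tspan.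
  by rewrite map_coefE; apply/push_size/ah_p.
have rho'_B k : ~~ trivial_word k -> is_boundary a' rho'@_k.
  move=> kN.
  have -> : rho'@_k = (be - push al2 - wdiff (trivial_action X' _) be2)@_k
      + (push (al2 - map_coef push ah))@_k - (sb@_k - (wdiff (trivial_action X' _) be2)@_k).
    have zE (V : zmodType) (b u v d s : V) : b - v - s = b - u - d + (u - v) - (s - d).
      rewrite opprB [RHS]addrAC [b - u - d + (d - s)]addrA subrK [b - u - s]addrAC.
      by rewrite [RHS]addrA subrK [RHS]addrAC.
    rewrite linearB !mcoeffB; exact: zE.
  apply: lin_closedB => //; last exact: sb_B.
  apply: lin_closedD => //; first exact: be2_B.
  exact: key_map_closed.
have [c' [c'_t c'_p c'E]] := kill_symbol rho'_t rho'_p rho'_B.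
(* [ah] and [be2] turn the symbol coefficients into boundaries; [c] and [c'] then remove these
   symbols. *)
exists (zX ah - c), (zX' be2 + c'); split.
- split; first by rewrite rpredB ?dup_map_degen // (sub_tspan (@rep_degen _ t)).
  by rewrite rpredD ?dup_map_degen // (sub_tspan (@rep_degen _ t.+1)).
- by rewrite rpredB ?(dup_map_size ah_t) // addSn.
- by rewrite rpredD // -addSn (dup_map_size be2_t).
- have -> : x + dX (zX ah - c) = x' + (zX (al + si) - dX c).
    by rewrite linearB linearD /= si_d {1}xE !addrA.
  exact: rpredD.
have -> : y - push (zX ah - c) - dX' (zX' be2 + c') =
    y' + push c + (zX' rho' - dX' c').
  have zE (V : zmodType) (u b v w s d : V) :
      u + b - (v - w) - (s + d) = u + w + (b - v - s - d).
    by rewrite opprB addrACA opprD -[b - v - s - d]addrA [RHS]addrA.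
  have -> : zX' rho' = zX' be - push (zX ah) - dX' (zX' be2).
    by rewrite sb_d (push_dup_map phi) -!linearB.
  rewrite (linearB push (zX ah) c) (linearD dX' (zX' be2) c') {1}yE; exact: zE.
by apply: rpredD => //; apply: rpredD => //; apply: push_rep.
Qed.

(** Each use of [lower_symbol] changes the cone cycle by a boundary and takes it one filtration step
    down; at s = 0 nothing is left. *)
Lemma degenerate_descent N s x y :
  (forall n, (n < N)%N -> cone_acyclic phi a a' n) ->
  x \in tspan (rep s.-1) -> y \in tspan (rep s) ->
  x \in tspan (fun w => (size w).+1 == N) -> y \in tspan (fun w => size w == N) ->
  dX x = 0 -> push x + dX' y = 0 ->
  exists x2 y2, [/\ x2 \in tspan (@degen X), y2 \in tspan (@degen X'),
    x2 \in tspan (fun w => size w == N), y2 \in tspan (fun w => size w == N.+1) &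
    x + dX x2 = 0 /\ y - push x2 - dX' y2 = 0].
Proof.
move=> acyc; elim: s x y => [|t IHt] x y xt yt xN yN dx dxy.
  have rep0 (Y : eqType) (w : seq Y) : rep 0 w -> xpred0 w by case: w.
  rewrite (tspan0 (sub_tspan (@rep0 _) xt)) (tspan0 (sub_tspan (@rep0 _) yt)).
  by exists 0, 0; rewrite !rpred0 !linear0 !addr0.
(* A word of length at most r satisfies [rep r] only if it satisfies [rep r.-1], so for small [N]
   the step down is free. *)
have [Nt|tN] := leqP N t.+1.
  have low (Y : spindleType) (c : tensfree M (seq Y)) r : c \in tspan (rep r) ->
      c \in tspan (fun w => size w <= r)%N -> c \in tspan (rep r.-1).
    move=> cr cs; have : c \in tspan (fun w => rep r w && (size w <= r)%N).
      by rewrite tspan_and cr.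
    apply: sub_tspan => w /andP[rw wr]; apply: degen_rep (rep_degen rw).
    by case: (size w) r wr {rw cr cs} => [|n] [|r].
  apply: IHt => //; first by apply: (low _ x) xt _; apply: sub_tspan xN => w /eqP wN; rewrite -ltnS wN.
  by apply: (low _ y) yt _; apply: sub_tspan yN => w /eqP->.
have [p NE] : exists p, N = (t.+1 + p).+1.
  by exists (N - t.+2)%N; rewrite -addSn subnKC.
have acyc_p n : (n <= p.+1)%N -> cone_acyclic phi a a' n.
  by move=> np; apply: acyc; rewrite NE addSn ltnS (leq_trans np) // ltnS leq_addl.
have xp : x \in tspan (fun w => size w == (t + p).+1).
  by move: xN; rewrite NE; apply: sub_tspan => w; rewrite eqSS addSn.
have yp : y \in tspan (fun w => size w == (t.+1 + p).+1) by rewrite -NE.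
have [x2 [y2 [[x2D y2D] x2N y2N x2t y2t]]] := lower_symbol acyc_p xt yt xp yp dx dxy.
rewrite -NE in x2N y2N.
have xN' : x + dX x2 \in tspan (fun w => (size w).+1 == N).
  by rewrite rpredD // wdiff_size.
have yN' : y - push x2 - dX' y2 \in tspan (fun w => size w == N).
  rewrite !rpredB //; first exact: push_size.
  by have := wdiff_size a' y2N; apply: sub_tspan => w; rewrite eqSS.
have [||x3 [y3 [x3D y3D x3N y3N [x3E y3E]]]] := IHt _ _ x2t y2t xN' yN'.
- by rewrite linearD /= dx wdiffK addr0.
- rewrite linearD !linearB /= (push_wdiff aa') wdiffK subr0.
  by rewrite addrACA dxy add0r subrr.
exists (x2 + x3), (y2 + y3); rewrite !rpredD //; split=> //.
rewrite linearD addrA x3E (linearD push) (linearD dX').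
have zE (V : zmodType) (u v w r s : V) : u - (v + w) - (r + s) = u - v - r - w - s.
  by rewrite !opprD !addrA; congr (_ - _); rewrite addrAC.
by split=> //; rewrite zE.
Qed.

Hypothesis normM : forall n, normalized_cone_acyclic phi a a' n.

(** The exact sequence of degenerate, full and normalized cones: after correction by a normalized
    filling, the remaining cycle is supported on trivial words, which are degenerate unless
    empty. *)
Lemma cone_acyclic_degenerate n :
  degenerate_cone_acyclic phi a a' n -> cone_acyclic phi a a' n.
Proof.
move=> Dn x y xn yn dx dxy.
have [||x1 [y1 [x1n y1n x1T y1T]]] := normM xn yn.
- by rewrite dx rpred0.
- by rewrite dxy rpred0.
have x'n : x + dX x1 \in tspan (fun w => (size w).+1 == n) by rewrite rpredD ?wdiff_size.
have y'n : y - push x1 - dX' y1 \in tspan (fun w => size w == n).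
  rewrite !rpredB //; first exact: push_size.
  by have := wdiff_size a' y1n; apply: sub_tspan => w; rewrite eqSS.
suff [x2 [y2 [x2n y2n x2E y2E]]] : exists x2 y2, [/\ x2 \in tspan (fun w => size w == n),
    y2 \in tspan (fun w => size w == n.+1),
    x + dX x1 + dX x2 = 0 & y - push x1 - dX' y1 - push x2 - dX' y2 = 0].
  exists (x1 + x2), (y1 + y2); rewrite !rpredD //; split=> //; first by rewrite linearD addrA.
  rewrite (linearD push) (linearD dX') !opprD !addrA.
  by rewrite [y - push x1 - push x2 - _]addrAC.
have dx' : dX (x + dX x1) = 0 by rewrite linearD /= dx wdiffK addr0.
have dxy' : push (x + dX x1) + dX' (y - push x1 - dX' y1) = 0.
  rewrite linearD !linearB /= (push_wdiff aa') wdiffK subr0.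
  by rewrite addrACA dxy add0r subrr.
move: {x y xn yn dx dxy x1n y1n} (x + _) (y - _ - _) x'n y'n x1T y1T dx' dxy' => x y xn yn xT yT dx dxy.
have trivial_size (Y : spindleType) (c : tensfree M (seq Y)) m : c \in tspan (@trivial_word Y) ->
    c \in tspan (fun w => size w == m.+1) -> c \in tspan (fun w => degen w && (size w == m.+1)).
  move=> cT cm; have : c \in tspan (fun w => trivial_word w && (size w == m.+1)).
    by rewrite tspan_and cT.
  by apply: sub_tspan => -[|z w] //.
have nilK (Y Y' : spindleType) (f : Y -> Y') (c : tensfree M (seq Y)) :
    c \in tspan (fun w => size w == 0%N) -> key_map (fun=> [::]) (key_map (map f) c) = c.
  move=> c0; apply: (eq_on_tspan (f := key_map (fun=> [::]) \o key_map (map f)) (g := idfun) c0).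
  by move=> w m /nilP->; rewrite /= !key_map_tens.
(* Empty words occur only in degrees 0 and 1, where [push] is bijective on them and one-letter words
   are never trivial. From degree 2 on, [Dn] applies. *)
case: n {Dn} xn yn (Dn) => [|[|n]] xn yn Dn.
- rewrite (tspan0 xn); exists (key_map (fun=> [::]) y), 0; split; rewrite ?rpred0 //.
  + by apply: key_map_tspan yn.
  + rewrite add0r; have -> // : dX (key_map (fun=> [::]) y) = 0.
    elim/tf_ind: (y) => [|c d Hc Hd|w m]; first by rewrite !linear0.
      by rewrite !linearD /= Hc Hd addr0.
    by rewrite key_map_tens wdiff_nil.
  rewrite linear0 subr0; apply/eqP; rewrite subr_eq0; apply/eqP/esym.
  apply: (eq_on_tspan (f := key_map (map phi) \o key_map (fun=> [::])) (g := idfun) yn).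
  by move=> w m /nilP->; rewrite /= !key_map_tens.
- have y0 : y = 0.
    apply: tspan0; apply: sub_tspan (trivial_size _ y _ yT yn) => w /andP[+ /eqP].
    by case: w => [|z [|z' w]].
  move: dxy; rewrite y0 linear0 addr0 => dxy.
  exists 0, 0; rewrite !rpred0 !linear0 !addr0; split=> //.
  by rewrite -(nilK _ _ phi x) ?dxy ?linear0.
have xd : x \in tspan (fun w => degen w && (size w == n.+1)) by apply: trivial_size.
have yd : y \in tspan (fun w => degen w && (size w == n.+2)) by apply: trivial_size.
move: xd yd; rewrite !tspan_and => /andP[xD _] /andP[yD _].
have [x2 [y2 [_ _ x2n y2n [x2E y2E]]]] := Dn x y xD yD xn yn dx dxy.
by exists x2, y2.
Qed.

(** Strong induction: acyclicity of the degenerate cone below degree N gives that of the full cone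
    there, which is what the descent requires in degree N. *)
Lemma degenerate_comparison n : degenerate_cone_acyclic phi a a' n.
Proof.
elim/ltn_ind: n => N IHN x y xD yD xN yN dx dxy.
apply: (@degenerate_descent N N) => //.
- by move=> n /IHN; apply: cone_acyclic_degenerate.
- have : x \in tspan (fun w => degen w && ((size w).+1 == N)) by rewrite tspan_and xD.
  by apply: sub_tspan => w /andP[wD /eqP <-]; apply: degen_rep wD; apply: leq_pred.
have : y \in tspan (fun w => degen w && (size w == N)) by rewrite tspan_and yD.
by apply: sub_tspan => w /andP[wD /eqP <-].
Qed.

End Comparison.

(** * Mapping cones and homology isomorphisms *)

Lemma cycle_diff (R : pzRingType) (C : chain_complex R) n (x : C n.+1) :
  (x \in @Defs.cycle R C n.+1) = (cdiff C n x == 0).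
Proof. by []. Qed.

Section HomologyCone.
Variables (R : pzRingType) (C D : chain_complex R) (f : chain_map C D).

(** Exactness of the mapping cone; degree 0 stands apart because its only component is [D 0]. *)
Definition chain_cone_acyclic :=
  (forall y : D 0%N, exists x z, y - f 0%N x - cdiff D 0 z = 0) /\
  (forall n (x : C n) (y : D n.+1), x \in @Defs.cycle R C n -> f n x + cdiff D n y = 0 ->
    exists x2 y2, x + cdiff C n x2 = 0 /\ y - f n.+1 x2 - cdiff D n.+1 y2 = 0).

(** Injectivity on homology provides v with boundary x; surjectivity then applies to the cycle y + f
    v. *)
Lemma bijective_cone_acyclic :
  (forall n, bijective (homology_map f n)) -> chain_cone_acyclic.
Proof.
move=> fbij.
have surj n (y : D n) : y \in @Defs.cycle R D n ->
    exists x z, [/\ x \in @Defs.cycle R C n & y - f n x = cdiff D n z].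
  move=> yc; have [g gK Kg] := fbij n.
  pose z : cycles D n := Submod yc; pose r := quot_repr (g (to_quot (@boundary R D n) z)).
  have : homology_map f n (to_quot (@boundary R C n) r) = to_quot (@boundary R D n) z.
    by rewrite quot_reprK Kg.
  rewrite [homology_map f n _]quot_mapE => /esym/to_quotP; rewrite unfold_in => /asboolP[u uE].
  exists (val r), u; split; first exact: valP.
  by rewrite uE.
have inj n (x : C n) z : x \in @Defs.cycle R C n -> f n x = cdiff D n z ->
    exists v, cdiff C n v = x.
  move=> xc xz; pose r : cycles C n := Submod xc.
  have : to_quot (@boundary R C n) r = to_quot (@boundary R C n) 0.
    apply: (bij_inj (fbij n)); rewrite ![homology_map f n _]quot_mapE.
    apply/to_quotP; rewrite linear0 subr0 unfold_in; apply/asboolP.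
    by exists z; rewrite -xz.
  by move/to_quotP; rewrite subr0 unfold_in => /asboolP[v vE]; exists v.
split=> [y|n x y xc xy].
  have [x [z [_ xzE]]] := surj 0%N y isT.
  by exists x, z; rewrite xzE subrr.
have [|v vE] := inj n x (- y) xc.
  by rewrite linearN; apply/eqP; rewrite -addr_eq0 xy.
have [|x1 [z [x1c zE]]] := surj n.+1 (y + f n.+1 v).
  by rewrite unfold_in /= linearD /= -cmap_diff vE addrC xy.
exists (x1 - v), z; move: x1c; rewrite cycle_diff => /eqP x1c; split.
  by rewrite linearB /= x1c vE add0r subrr.
by rewrite linearB opprB -zE addrA subrr.
Qed.

(** Injectivity comes from the pairs (x, -u) with f x = d u; surjectivity from the pairs (0, y), or
    from the first clause in degree 0. *)
Lemma cone_acyclic_bijective :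
  chain_cone_acyclic -> forall n, bijective (homology_map f n).
Proof.
move=> [ac0 acS] n.
have ker0 q : homology_map f n q = 0 -> q = 0.
  rewrite -(quot_reprK q); set r := quot_repr q.
  rewrite [homology_map f n _]quot_mapE -(linear0 (to_quot (@boundary R D n))).
  move=> /to_quotP; rewrite subr0 unfold_in => /asboolP[u uE].
  have [||x2 [_ [x2E _]]] := acS n (val r) (- u).
  - exact: valP.
  - by rewrite linearN uE subrr.
  rewrite -(linear0 (to_quot (@boundary R C n))); apply/to_quotP.
  rewrite subr0 unfold_in; apply/asboolP; exists (- x2).
  by apply/eqP; rewrite linearN eq_sym -addr_eq0 x2E.
have inj : injective (homology_map f n).
  move=> p q pq; apply/eqP; rewrite -subr_eq0; apply/eqP/ker0.
  by rewrite (linearB (homology_map f n)) pq subrr.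
have surj q : exists p, homology_map f n p = q.
  rewrite -(quot_reprK q); set z := quot_repr q.
  have [x [u [xc uE]]] : exists x u, [/\ x \in @Defs.cycle R C n & val z - f n x = cdiff D n u].
    case: n {ker0 inj} q z => [|n] q z.
      have [x [u uE]] := ac0 (val z); exists x, u; split=> //.
      by apply/eqP; rewrite -subr_eq0 uE.
    have [||x [u [xE uE]]] := acS n 0 (val z).
    - by rewrite rpred0.
    - by rewrite linear0 add0r; apply/eqP; rewrite -cycle_diff; exact: valP.
    exists x, u; split; last by apply/eqP; rewrite -subr_eq0 uE.
    by rewrite cycle_diff -(add0r (cdiff _ _ _)) xE.
  exists (to_quot (@boundary R C n) (Submod xc)); rewrite [homology_map f n _]quot_mapE.
  apply/esym/to_quotP; rewrite unfold_in; apply/asboolP; exists u.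
  by rewrite -uE.
have /choice[g gE] := surj.
by exists g => // p; apply: inj; rewrite gE.
Qed.

End HomologyCone.

(** * From indexed sequences to words *)

Section WordFaces.
Variables (R : comPzRingType) (X : spindleType) (M : lmodType R) (a : action X M).

Definition word_face (op : X -> X -> X) (x0 : X) (i : nat) (w : seq X) : seq X :=
  take i w ++ [seq op y (nth x0 w i) | y <- drop i.+1 w].

Lemma wdiff_faces x0 w m : wdiff a (tens w m) =
  \sum_(i < size w) (-1) ^+ i *: (tens (word_face (fun x _ => x) x0 i w) m
    - tens (word_face sop x0 i w) (a (nth x0 w i) m)).
Proof.
elim: w => [|x w IHw]; first by rewrite wdiff_nil big_ord0.
rewrite wdiff_cons big_ord_recl expr0 scale1r /word_face /= drop0 map_id word_act_tens.
congr (_ + _); rewrite IHw linear_sum -sumrN; apply: eq_bigr => i _.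
by rewrite linearZZ exprS mulN1r scaleNr linearB /= !push_letter_tens.
Qed.

End WordFaces.

Section ToWord.
Variables (X : spindleType) (n : nat).

Definition word_of (x : seqs X n) : seq X := mkseq (fun i => x (inord i)) n.+1.

Lemma size_word_of x : size (word_of x) = n.+1.
Proof. exact: size_mkseq. Qed.

Lemma nth_word_of y x (i : 'I_n.+1) : nth y (word_of x) i = x i.
Proof. by rewrite nth_mkseq // inord_val. Qed.

Lemma word_of_inj : injective word_of.
Proof.
move=> x y xy; apply/ffunP => i.
by rewrite -(nth_word_of (x ord0)) xy nth_word_of.
Qed.

Lemma degenerate_word_of x : degenerate x = degen (word_of x).
Proof.
have degenP y (w : seq X) : degen w = [exists i : 'I_(size w).-1, nth y w i == nth y w i.+1].
  elim: w => [|z [|z' w] IHw].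
  - by apply/esym/negbTE/existsP => -[[]].
  - by apply/esym/negbTE/existsP => -[[]].
  rewrite /degen [size _]/= repS [rep _ _]IHw.
  apply/orP/existsP => [[zz'|/existsP[i iE]]|[[[|i] ilt] iE]].
  - by exists ord0.
  - by exists (lift ord0 i).
  - by left.
  by right; apply/existsP; exists (Ordinal (ilt : (i < (size (z' :: w)).-1)%N)).
rewrite (degenP (x ord0)); apply/existsP/existsP => [[i /existsP[j /andP[/eqP ji /eqP xji]]]|[i iE]].
  have ilt : (i < (size (word_of x)).-1)%N.
    by rewrite size_word_of /= -ltnS -ji.
  exists (Ordinal ilt); apply/eqP.
  by rewrite -[nat_of_ord (Ordinal _)]/(nat_of_ord i) -ji !nth_word_of.
have ilt : (i.+1 < n.+1)%N by have := ltn_ord i; rewrite {2}size_word_of ltnS.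
exists (Ordinal (ltnW ilt)); apply/existsP; exists (Ordinal ilt); rewrite eqxx /=.
by move: iE; rewrite (nth_word_of _ _ (Ordinal ilt)) (nth_word_of _ _ (Ordinal (ltnW ilt))) eq_sym.
Qed.

End ToWord.

Section ToWordChains.
Variables (R : comPzRingType) (X : spindleType) (M : lmodType R) (a : action X M).

Definition to_word n : {linear chains M X n -> tensfree M (seq X)} := key_map (@word_of X n).

(** The head letter is the default of [nth], which is not reached on words of length n + 1. *)
Definition of_word n : {linear tensfree M (seq X) -> chains M X n} :=
  tf_ext (fun w => if w is y :: _ then tens [ffun i : 'I_n.+1 => nth y w i] : {linear _ -> _}
                   else \0).

Lemma to_word_size n c : to_word n c \in tspan (fun w => size w == n.+1).
Proof.
apply: (@key_map_tspan _ _ _ _ _ predT) => [x _|]; first by rewrite size_word_of.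
exact/tspanP.
Qed.

Lemma to_word_inj n : injective (to_word n).
Proof.
move=> c d cd; apply/malgP => x.
by rewrite -(key_map_inj _ c (@word_of_inj _ n)) -(key_map_inj _ d (@word_of_inj _ n)) [key_map _ c]cd.
Qed.

Lemma of_wordK n c : c \in tspan (fun w => size w == n.+1) -> to_word n (of_word n c) = c.
Proof.
move=> cn; apply: (eq_on_tspan (f := to_word n \o of_word n) (g := idfun) cn) => w m /= /eqP wn.
case: w wn => // y w wn; rewrite [of_word _ _]tf_ext_tens [to_word _ _]key_map_tens.
congr (tens _ _); apply: (@eq_from_nth _ y) => [|i]; rewrite size_word_of // => iltn.
by rewrite (nth_word_of _ _ (Ordinal iltn)) ffunE.
Qed.

Lemma to_word_degenerate n (c : rack_complex a n) :
  (c \in @degenerate_chain _ _ _ a n) = (to_word n c \in tspan (@degen X)).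
Proof.
apply/idP/idP => [cD|/tspanP cD].
  by apply: (key_map_tspan (P := @degenerate X n)) => // x; rewrite degenerate_word_of.
rewrite -[_ \in _]/((c : chains M X n) \in tspan (@degenerate X n)).
apply/tspanP => x xN; rewrite -(key_map_inj _ _ (@word_of_inj _ n)).
by apply: cD; rewrite -degenerate_word_of.
Qed.

Lemma to_word_trivial n (c : chains M X n) :
  (to_word n c \in tspan (@trivial_word X)) = (to_word n c \in tspan (@degen X)).
Proof.
apply/idP/idP => [cT|]; last by apply: sub_tspan => w wD; rewrite /trivial_word wD orbT.
have : to_word n c \in tspan (fun w => trivial_word w && (size w == n.+1)).
  by rewrite tspan_and cT to_word_size.
by apply: sub_tspan => -[|y w] //= /andP[].
Qed.

Lemma word_of_face op n x0 (i : 'I_n.+2) (x : seqs X n.+1) :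
  word_of (face_seq op i x) = word_face op x0 i (word_of x).
Proof.
have si : size (word_face op x0 i (word_of x)) = n.+1.
  rewrite size_cat size_map size_drop size_take size_word_of ltn_ord subSS.
  by rewrite subnKC // -ltnS.
apply: (@eq_from_nth _ x0) => [|k]; rewrite size_word_of ?si // => kn.
rewrite (nth_word_of _ _ (Ordinal kn)) ffunE /word_face nth_cat size_take size_word_of ltn_ord.
have liftE : x (lift i (Ordinal kn)) = nth x0 (word_of x) (lift i (Ordinal kn)).
  by rewrite nth_word_of.
rewrite [(Ordinal kn < i)%N]/(k < i)%N; case: ifPn => ki.
  by rewrite nth_take // liftE; congr (nth _ _ _); rewrite /= /bump; lia.
rewrite -leqNgt in ki.
rewrite (nth_map x0) ?size_drop ?size_word_of ?subSS; last by rewrite ltn_sub2r // (leq_ltn_trans ki).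
by rewrite nth_drop addSn subnKC // nth_word_of liftE /= /bump ki add1n.
Qed.

(** Rack signs count from the top index, word signs from the first letter: (-1)^(n+1-i) = (-1)^(n+1)
    (-1)^i. *)
Lemma to_word_rack_diff n (c : chains M X n.+1) :
  to_word n (rack_diff a c) = (-1) ^+ n.+1 *: wdiff a (to_word n.+1 c).
Proof.
pose f : {linear chains M X n.+1 -> tensfree M (seq X)} := to_word n \o @rack_diff R X M a n.
pose g : {linear chains M X n.+1 -> tensfree M (seq X)} :=
  GRing.scale ((-1) ^+ n.+1) \o (wdiff a \o to_word n.+1).
move: c; apply: (@eq_tensfree _ _ _ _ f g) => x m.
rewrite -[f _]/(to_word n (rack_diff a (tens x m))) -[g _]/(_ *: wdiff a (to_word n.+1 _)).
rewrite [to_word n.+1 _]key_map_tens (wdiff_faces a (x ord0)) scaler_sumr rack_diffE (linear_sum (to_word n)).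
rewrite size_word_of; apply: eq_bigr => i _.
rewrite (linearZZ (to_word n)) scalerA; congr (_ *: _).
  by rewrite -exprD -signr_odd -[RHS]signr_odd oddD oddB ?leq_ord.
rewrite /rack_face !face_tens (linearB (to_word n)) /to_word !key_map_tens /=.
by rewrite !(word_of_face _ (x ord0)) nth_word_of.
Qed.

End ToWordChains.

(** * Transfer to the homology maps *)

Section Bridge.
Variables (R : comPzRingType) (X X' : spindleType) (phi : spindle_hom X X').
Variables (M : lmodType R) (a : action X M) (a' : action X' M).
Hypothesis aa' : compatible phi a a'.

Lemma to_word_push n (c : chains M X n) :
  to_word X' M n (push phi M n c) = key_map (map phi) (to_word X M n c).
Proof.
elim/tf_ind: c => [|c d Hc Hd|x m]; first by rewrite !linear0.
  by rewrite !linearD /= Hc Hd.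
rewrite push_tens /to_word !key_map_tens; congr (tens _ _).
by rewrite /word_of /mkseq -map_comp; apply: eq_map => i; rewrite /= ffunE.
Qed.

Lemma normalized_cone : (forall n, bijective (HN_map phi a a' aa' n)) ->
  forall n, normalized_cone_acyclic phi a a' n.
Proof.
move=> /bijective_cone_acyclic[ac0 acS].
have degE (Y : spindleType) (b : action Y M) n (c : rack_complex b n) :
    (to_quot (@degenerate_chain _ _ _ b n) c = 0) <-> to_word Y M n c \in tspan (@trivial_word Y).
  rewrite to_word_trivial -(to_word_degenerate (a := b) c) -(linear0 (to_quot (@degenerate_chain _ _ _ b n))).
  by split=> [/to_quotP|cD]; [rewrite subr0 | apply/to_quotP; rewrite subr0].
have diffE (Y : spindleType) (b : action Y M) n (c : rack_complex b n.+1) :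
    cdiff (normalized_complex b) n (to_quot (@degenerate_chain _ _ _ b n.+1) c) =
    to_quot (@degenerate_chain _ _ _ b n) (rack_diff b c) by apply: quot_mapE.
have nil_trivial (Y : spindleType) (c : tensfree M (seq Y)) :
    c \in tspan (fun w => size w == 0%N) -> c \in tspan (@trivial_word Y).
  by apply: sub_tspan => w /nilP->.
(* Words of length n + 1 are chains of degree n: degree 0 of the word cone holds only empty words,
   degree 1 is the first clause of acyclicity, and degree k + 2 is the second clause at k. *)
case=> [|[|k]] x y xn yn xT yT.
- exists 0, 0; rewrite !rpred0 !linear0 !addr0 (tspan0 xn).
  by split; rewrite ?rpred0 // nil_trivial.
- have [p [q]] := ac0 (to_quot (@degenerate_chain _ _ _ a' 0) (of_word X' M 0 y)).
  rewrite -(quot_reprK p) -(quot_reprK q) [quotcomplex_map _ _ _ _ _]quot_mapE diffE.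
  move: (quot_repr p) (quot_repr q) => {p q} p q; rewrite -!linearB => /degE xyT.
  have {}xyT : y - key_map (map phi) (to_word X M 0 p) - wdiff a' (- to_word X' M 1 q)
      \in tspan (@trivial_word X').
    move: xyT; set c := (_ - _ : rack_complex a' 0).
    suff -> : to_word X' M 0 c = y - key_map (map phi) (to_word X M 0 p) - wdiff a' (- to_word X' M 1 q) by [].
    have := to_word_rack_diff a' q; rewrite expr1 scaleN1r -linearN => <-.
    by rewrite -to_word_push -{1}(of_wordK yn) -!linearB.
  exists (to_word X M 0 p), (- to_word X' M 1 q); split=> //.
  + exact: to_word_size.
  + by rewrite rpredN; apply: to_word_size.
  apply: nil_trivial; apply: (@sub_tspan _ _ _ (fun w => (size w).+1 == 1%N)) => //.
  by rewrite rpredD // wdiff_size // to_word_size.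
(* The sign between [wdiff] and [rack_diff] in degree k + 1; rescaling [y] by it matches the two
   cone conditions. *)
pose e : R := (-1) ^+ k.+1.
have ee : e * e = 1 by rewrite -expr2 sqrr_sign.
pose A := to_quot (@degenerate_chain _ _ _ a k) (of_word X M k x).
pose B := to_quot (@degenerate_chain _ _ _ a' k.+1) (e *: of_word X' M k.+1 y).
have [||p [q []]] := acS k A B.
- rewrite {}/A {B}; case: k {e ee yn yT} x xn xT => // k x xn xT; rewrite cycle_diff diffE; apply/eqP.
  apply/degE; rewrite to_word_rack_diff of_wordK // rpredZ //.
- rewrite [quotcomplex_map _ _ _ _ _]quot_mapE diffE -linearD; apply/degE.
  rewrite linearD /= to_word_push to_word_rack_diff linearZZ !of_wordK //.
  by rewrite linearZZ scalerA ee scale1r.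
rewrite -(quot_reprK p) -(quot_reprK q) [quotcomplex_map _ _ _ _ _]quot_mapE !diffE.
move: (quot_repr p) (quot_repr q) => {p q} p q; rewrite -!linearB -linearD => /degE xT' /degE yT'.
exists (e *: to_word X M k.+1 p), (- to_word X' M k.+2 q); split.
- by rewrite rpredZ // to_word_size.
- by rewrite rpredN to_word_size.
- by move: xT'; rewrite linearD /= to_word_rack_diff of_wordK // linearZZ.
have e0 : e *: y = to_word X' M k.+1 (e *: of_word X' M k.+1 y) by rewrite linearZZ of_wordK.
have e1 : e *: key_map (map phi) (e *: to_word X M k.+1 p) = to_word X' M k.+1 (push phi M k.+1 p).
  by rewrite linearZZ scalerA ee scale1r to_word_push.
have e2 : e *: wdiff a' (- to_word X' M k.+2 q) = to_word X' M k.+1 (rack_diff a' q).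
  by rewrite to_word_rack_diff exprS mulN1r scaleNr linearN scalerN.
rewrite -[_ - _]scale1r -ee -scalerA rpredZ // !scalerBr e0 e1 e2 -!linearB.
exact: yT'.
Qed.

Lemma degenerate_bijective : (forall n, degenerate_cone_acyclic phi a a' n) ->
  forall n, bijective (HD_map phi a a' aa' n).
Proof.
move=> ac; apply: cone_acyclic_bijective; split=> [y|k x y xc xy].
  (* A sequence with one entry has no consecutive pair, so degenerate chains vanish in degree 0. *)
  exists 0, 0; rewrite !linear0 !addr0; apply: val_inj.
  have /tspanP y0 : (val y : chains M X' 0) \in tspan (@degenerate X' 0) := valP y.
  apply/malgP => w; rewrite y0 ?mcoeff0 //.
  by apply/existsP => -[i /existsP[j /andP[+ _]]]; rewrite !ord1.
pose e : R := (-1) ^+ k.+1.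
have ee : e * e = 1 by rewrite -expr2 sqrr_sign.
pose u := to_word X M k (val x); pose v := to_word X' M k.+1 (val y).
have [||||||p [q [pD qD pn qn [xE yE]]]] := ac k.+2 u (e *: v).
- by rewrite -(to_word_degenerate (a := a)); apply: valP.
- by rewrite rpredZ // -(to_word_degenerate (a := a')); apply: valP.
- exact: to_word_size.
- by rewrite rpredZ // to_word_size.
(* Being a cycle is no condition in degree 0, whereas [wdiff] is augmented there; but degenerate
   chains of one-letter words are zero. *)
- rewrite /u {u}; case: k {e ee y xy v} x xc => [|k] x xc.
    set u := to_word _ _ _ _.
    have u1 : u \in tspan (fun w => size w == 1%N) := to_word_size _.
    have uD : u \in tspan (@degen X) by rewrite -(to_word_degenerate (a := a)); apply: valP.
    suff -> : u = 0 by rewrite linear0.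
    apply: tspan0; have : u \in tspan (fun w => degen w && (size w == 1%N)) by rewrite tspan_and uD.
    by apply: sub_tspan => w /andP[+ /eqP]; case: w => [|z [|z' w]].
  have x0 : rack_diff a (val x) = 0.
    by move: xc; rewrite cycle_diff => /eqP /(congr1 val).
  have := to_word_rack_diff a (val x); rewrite x0 linear0 => /(congr1 (GRing.scale ((-1) ^+ k.+1))).
  by rewrite scaler0 scalerA -expr2 sqrr_sign scale1r.
- have xyE : push phi M k (val x) + rack_diff a' (val y) = 0 := congr1 val xy.
  have := linearD (to_word X' M k) (push phi M k (val x)) (rack_diff a' (val y)).
  by rewrite xyE linear0 to_word_push to_word_rack_diff linearZZ.
have pC : of_word X M k.+1 (e *: p) \in @degenerate_chain _ _ _ a k.+1.
  by rewrite to_word_degenerate of_wordK rpredZ.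
have qC : of_word X' M k.+2 (- q) \in @degenerate_chain _ _ _ a' k.+2.
  by rewrite to_word_degenerate of_wordK rpredN.
exists (Submod pC), (Submod qC); split; apply: val_inj; apply: to_word_inj; rewrite linear0.
  rewrite -[RHS]xE [LHS](linearD (to_word X M k) (val x)) to_word_rack_diff of_wordK ?rpredZ //.
  by rewrite linearZZ scalerA ee scale1r.
transitivity (e *: (e *: v - key_map (map phi) p - wdiff a' q)); last by rewrite yE scaler0.
rewrite [LHS](linearB (to_word X' M k.+1) (val y - _)) [X in X - _](linearB (to_word X' M k.+1) (val y)).
rewrite to_word_push to_word_rack_diff !of_wordK ?rpredZ ?rpredN // !scalerBr scalerA ee scale1r.
by rewrite exprS mulN1r scaleNr opprK (linearN (wdiff a')) scalerN linearZZ.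
Qed.

End Bridge.

Theorem corollary7p2 (R : comPzRingType) (X X' : spindleType)
    (phi : spindle_hom X X') (M : lmodType R) (a : action X' M)
    (isoN : forall n : nat,
      bijective (HN_map phi (trivial_action X R^o) (trivial_action X' R^o)
                   (trivial_compatible phi R^o) n))
    (isoNM : forall n : nat,
      bijective (HN_map phi (pullback phi a) a (pullback_compatible phi a) n)) :
  forall n : nat,
    bijective (HD_map phi (pullback phi a) a (pullback_compatible phi a) n).
Proof.
apply: degenerate_bijective; apply: degenerate_comparison => //.
- exact: normalized_cone isoN.
- exact: normalized_cone isoNM.
Qed.
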